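(* Let $n\ge 2$, $m\ge 1$ and $0\le k\le m-1$. Let $f\in\mathcal{S}(S^m)$ be a $(k+1)$-solenoidal tensor field in $\mathbb{R}^n$, that is, $\delta^{k+1}f=0$. Then $$\mathcal{I}^k f=0\quad\Longrightarrow\quad f\equiv 0 .$$ In other words, the operator $\mathcal{I}^k$ is injective over $(k+1)$-solenoidal tensor fields in $\mathcal{S}(S^m)$.
   Context: $\mathcal{S}(S^m)$ denotes the symmetric $m$-tensor fields on $\mathbb{R}^n$ whose components are Schwartz functions. The divergence of a smooth symmetric $m$-tensor field $u$ is $(\delta u)_{i_1\dots i_{m-1}}=\sum_{j=1}^n\frac{\partial u_{i_1\dots i_{m-1}j}}{\partial x_j}$, and $\delta^{k+1}$ is its $(k+1)$-fold iterate. Let $T\mathbb{S}^{n-1}=\{(x,\xi)\in\mathbb{R}^n\times\mathbb{R}^n : |\xi|=1,\ \langle x,\xi\rangle=0\}$. For an integer $q\ge 0$, the $q$-th integral moment transform of $f\in\mathcal{S}(S^m)$ is $$(I^q f)(x,\xi)=\int_{-\infty}^{\infty}t^q f_{i_1\dots i_m}(x+t\xi)\,\xi^{i_1}\cdots\xi^{i_m}\,dt,\qquad (x,\xi)\in T\mathbb{S}^{n-1}$$ (summation over repeated indices). The operator $\mathcal{I}^k$ is the collection of the first $k+1$ integral moment transforms: $\mathcal{I}^k f=(I^0f,I^1f,\dots,I^kf)$. *)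

(* Defs.v *)
From mathcomp Require Import all_boot all_order all_algebra all_fingroup.
From mathcomp Require Import all_classical all_reals all_analysis.
From mathcomp Require Export complex.
Set Implicit Arguments.
Unset Strict Implicit.
Unset Printing Implicit Defensive.
Import Order.TTheory GRing.Theory Num.Theory.
Import numFieldNormedType.Exports.
Local Open Scope classical_set_scope.
Local Open Scope ring_scope.
Local Open Scope complex_scope.

(* Points of R^n are row vectors.  The library norm on 'rV[R]_n is the sup norm,
   hence the Euclidean structure below. *)
Definition dotp (R : realType) (n : nat) (x y : 'rV[R]_n) : R :=
  \sum_(i < n) x 0 i * y 0 i.

Definition enorm (R : realType) (n : nat) (x : 'rV[R]_n) : R :=
  Num.sqrt (dotp x x).

Definition pderiv (R : realType) (n : nat) (i : 'I_n) (g : 'rV[R]_n -> R) :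
  'rV[R]_n -> R := fun x => 'D_(delta_mx 0 i) g x.

Definition pderivs (R : realType) (n : nat) (s : seq 'I_n) (g : 'rV[R]_n -> R) :
  'rV[R]_n -> R := foldr (@pderiv R n) g s.

(* 'D_v g is total: it is a junk value where g is not derivable along v, so the
   existence of all the iterated derivatives is required explicitly. *)
Definition smooth (R : realType) (n : nat) (g : 'rV[R]_n -> R) : Prop :=
  forall s : seq 'I_n, continuous (pderivs s g) /\
    forall (i : 'I_n) (x : 'rV[R]_n), derivable (pderivs s g) x (delta_mx 0 i).

Definition schwartz (R : realType) (n : nat) (g : 'rV[R]_n -> R) : Prop :=
  smooth g /\
  forall (alpha : 'I_n -> nat) (s : seq 'I_n), exists M : R,
    forall x : 'rV[R]_n,
      `|(\prod_(i < n) x 0 i ^+ alpha i) * pderivs s g x| <= M.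

(* Fields are complex-valued.  R[i] is not a normed module over R in the library,
   so Schwartz regularity, partial derivatives and integrals of complex-valued
   functions are taken on the real and imaginary parts. *)
Definition cschwartz (R : realType) (n : nat) (g : 'rV[R]_n -> R[i]) : Prop :=
  schwartz (fun x => complex.Re (g x)) /\ schwartz (fun x => complex.Im (g x)).

Definition cpderiv (R : realType) (n : nat) (i : 'I_n) (g : 'rV[R]_n -> R[i]) :
  'rV[R]_n -> R[i] :=
  fun x => pderiv i (fun y => complex.Re (g y)) x
           +i* pderiv i (fun y => complex.Im (g y)) x.

Definition cintegral (R : realType) (g : R -> R[i]) : R[i] :=
  (\int[lebesgue_measure]_t complex.Re (g t))
  +i* (\int[lebesgue_measure]_t complex.Im (g t)).

Definition tfield (R : realType) (n m : nat) : Type :=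
  m.-tuple 'I_n -> 'rV[R]_n -> R[i].

Definition symmetric_tfield (R : realType) (n m : nat) (f : tfield R n m) : Prop :=
  forall (s : 'S_m) (I : m.-tuple 'I_n),
    f [tuple tnth I (s j) | j < m] = f I.

Definition schwartz_tfield (R : realType) (n m : nat) (f : tfield R n m) : Prop :=
  symmetric_tfield f /\ forall I : m.-tuple 'I_n, cschwartz (f I).

(* The divergence of a 0-tensor field is 0 by convention. *)
Definition divergence (R : realType) (n m : nat) : tfield R n m -> tfield R n m.-1 :=
  match m return tfield R n m -> tfield R n m.-1 with
  | 0 => fun _ _ _ => 0
  | m'.+1 => fun u I x => \sum_(j < n) cpderiv j (u (rcons_tuple I j)) x
  end.

(* The p-fold divergence of an m-tensor field has order m - p, written as the
   p-fold predecessor of m so that the types compose without casts. *)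
Fixpoint iter_divergence (R : realType) (n m p : nat) (f : tfield R n m) :
  tfield R n (iter p predn m) :=
  match p return tfield R n (iter p predn m) with
  | 0 => f
  | p'.+1 => divergence (@iter_divergence R n m p' f)
  end.
Arguments iter_divergence {R n m} p f I x.

Definition TSphere (R : realType) (n : nat) : set ('rV[R]_n * 'rV[R]_n) :=
  [set p | enorm p.2 = 1 /\ dotp p.1 p.2 = 0].
Arguments TSphere R n : clear implicits.

(* f_{i_1...i_m}(y) xi^{i_1}...xi^{i_m} *)
Definition ray_contraction (R : realType) (n m : nat) (f : tfield R n m)
    (y xi : 'rV[R]_n) : R[i] :=
  \sum_(I : m.-tuple 'I_n) f I y * (\prod_(j < m) xi 0 (tnth I j))%:C.

Definition moment_transform (R : realType) (n m q : nat) (f : tfield R n m)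
    (p : TSphere R n) : R[i] :=
  let: (x, xi) := val p in
  cintegral (fun t : R => (t ^+ q)%:C * ray_contraction f (x + t *: xi) xi).

Definition moment_transforms (R : realType) (n m k : nat) (f : tfield R n m) :
  'I_k.+1 -> TSphere R n -> R[i] :=
  fun q => moment_transform q f.
Arguments moment_transforms {R n m} k f q p.

(* Main.v *)
(* Let F(y, xi) be the Fourier transform of f at y, contracted m times with xi.
   Integrating along the lines directed by xi first, and replacing the oscillating
   factor exp(i t <xi, y>) by its remainder of order k + 1 (the lower Taylor terms
   are killed by the vanishing moments), gives
     |F(y, xi)| <= C |<xi, y>|^(k+1), uniformly for xi in a bounded set.
   For fixed y and xi0 orthogonal to y, p(s) = F(y, xi0 + s y) is a polynomial
   which is therefore O(s^(k+1)) at 0; on the other hand delta^(k+1) f = 0 means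
   that k + 1 contractions of the Fourier transform with y vanish, so that p has
   degree at most k.  Hence p = 0, F(y, .) = 0, and by polarization and Fourier
   inversion f = 0.  Only the y whose coordinates are all nonzero are used.

   Real and imaginary parts of f are treated separately.  Fourier injectivity is
   reduced to dimension one, coordinate by coordinate, and obtained there from the
   Fejer kernel. *)
Require Import Defs.
From mathcomp Require Import all_boot all_order all_algebra all_fingroup.
From mathcomp Require Import all_classical all_reals all_analysis.
From mathcomp Require Import ring lra measurable_realfun.
Set Implicit Arguments.
Unset Strict Implicit.
Unset Printing Implicit Defensive.
Import Order.TTheory GRing.Theory Num.Theory.
Import numFieldNormedType.Exports.
Local Open Scope classical_set_scope.
Local Open Scope ring_scope.

(** * Integrals of continuous functions on the line *)

(** One coordinate, [o], parametrizes the lines directed by [xi], so the basic estimate is available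
    only for [xi] with [o]-coordinate 1. On the line [xi0 + s y] this forces a rescaling that
    depends on [s]; hence the constants are tracked explicitly and must not depend on [xi].
    Directions with [o]-coordinate 0 are recovered last, from the fact that a polynomial vanishing
    off one point is zero. Moving away from them without leaving the hyperplane orthogonal to [y]
    takes a vector orthogonal to [y] with [o]-coordinate 1; it is built from a second coordinate
    [o'] and from [y 0 o' != 0]. This is where [n >= 2] enters and why only such [y] are considered.
    Inversion tolerates the restriction because the Fejer weight ignores frequency 0.

    All integrals over R^n are iterated, so each exchange of order needs a product bound by factors
    1 + x_i^2. Passing to lines directed by [xi] loses one power of 1 + x_o^2 for each other
    coordinate, which Schwartz decay repays. *)

Section OneDim.
Context {R : realType}.
Notation mu := (@lebesgue_measure R).
Implicit Types phi psi : R -> R.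

(* The side condition under which all one-dimensional integrals below are taken:
   it gives integrability, and domination by the same function for limits. *)
Definition decay1 phi := continuous phi /\
  exists M : R, forall t, `|phi t| <= M / oneDsqr t.

Lemma oneDsqr_gt0 (x : R) : 0 < oneDsqr x.
Proof. by []. Qed.

Lemma integrable_oneDsqrV :
  mu.-integrable setT (EFin \o (fun t : R => (oneDsqr t)^-1)).
Proof.
have ge0 (x : R) : 0 <= (oneDsqr x)^-1 by rewrite invr_ge0 ltW // oneDsqr_gt0.
apply/integrableP; split.
  apply/measurable_EFinP; apply: continuous_measurable_fun => x.
  exact: continuous_oneDsqrV.
rewrite (_ : (\int[mu]_x _)%E = (\int[mu]_x ((oneDsqr x)^-1)%:E)%E); last first.
  by apply: eq_integral => x _ /=; rewrite ger0_norm.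
rewrite ge0_symfun_integralT //.
- rewrite (_ : [set x | 0 <= x] = `[0, +oo[%classic); last first.
    by apply/seteqP; split => x /=; rewrite in_itv /= andbT.
  by rewrite integral0y_oneDsqr -EFinM ltry.
- by move=> x; exact: continuous_oneDsqrV.
- by move=> x /=; rewrite /oneDsqr sqrrN.
Qed.

Definition oneDsqrV_int := \int[mu]_t (oneDsqr t)^-1.

Lemma integrable_bound phi (M : R) : measurable_fun setT phi ->
  (forall t, `|phi t| <= M / oneDsqr t) -> mu.-integrable setT (EFin \o phi).
Proof.
move=> mphi hM.
have iM := integrableZl measurableT M integrable_oneDsqrV.
apply: (le_integrable _ _ _ iM) => //.
  by apply/measurable_EFinP; exact: mphi.
move=> t _ /=; rewrite lee_fin (le_trans (hM t)) //; exact: ler_norm.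
Qed.

Lemma decay1_integrable phi : decay1 phi -> mu.-integrable setT (EFin \o phi).
Proof.
move=> [cphi [M hM]]; apply: integrable_bound hM.
exact: continuous_measurable_fun.
Qed.

Lemma le_int1 phi (M : R) : measurable_fun setT phi ->
  (forall t, `|phi t| <= M / oneDsqr t) -> `|\int[mu]_t phi t| <= M * oneDsqrV_int.
Proof.
move=> mphi hM.
have iphi := integrable_bound mphi hM.
apply: (le_trans (le_normr_Rintegral _ iphi)) => //.
rewrite -RintegralZl //; last exact: integrable_oneDsqrV.
apply: le_Rintegral => //.
- exact: integrable_norm iphi.
- exact: (integrableZl measurableT M integrable_oneDsqrV).
Qed.

Lemma int1_cvg (phi_ : nat -> R -> R) phi (M : R) :
  (forall n, measurable_fun setT (phi_ n)) ->
  (forall n t, `|phi_ n t| <= M / oneDsqr t) ->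
  (forall t, phi_ n t @[n --> \oo] --> phi t) ->
  (\int[mu]_t phi_ n t) @[n --> \oo] --> \int[mu]_t phi t.
Proof.
move=> mphi_ hM cvphi.
have iM := integrableZl measurableT M integrable_oneDsqrV.
have mphi : measurable_fun setT phi.
  by apply: measurable_fun_cvg => [//|x _]; exact: cvphi.
apply: fine_cvg; rewrite fineK; last first.
  apply: integrable_fin_num => //.
  apply: (le_integrable _ _ _ iM) => //; first exact/measurable_EFinP.
  move=> t _ /=; rewrite lee_fin.
  apply: le_trans (ler_norm _).
  by apply: (cvgr_to_le (cvg_norm (cvphi t))); apply: nearW => n; exact: hM.
apply: (@dominated_cvg _ _ _ mu setT measurableT (fun n => EFin \o phi_ n)
   (EFin \o phi) _ _ _ _ iM).
- by move=> n; apply/measurable_EFinP; exact: mphi_.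
- by move=> t _; apply: cvg_EFin; [exact: nearW | exact: cvphi].
- by [].
- by move=> n t _; rewrite lee_fin.
Qed.

(** Dominated convergence is available along sequences, while continuity in a parameter concerns a
    filter. If the limit failed, one bad point in each ball of radius 1/(n+1) would form a sequence
    contradicting the hypothesis. *)
Lemma cvg_seqP (V : normedModType R) (f : V -> R) (p : V) :
  (forall u : nat -> V, u n @[n --> \oo] --> p -> f (u n) @[n --> \oo] --> f p) ->
  f x @[x --> p] --> f p.
Proof.
move=> H; apply/cvgrPdist_lt => e e0; apply: contrapT => nnear.
have ex (n : nat) : exists x : V, `|p - x| < n.+1%:R^-1 /\ ~ (`|f p - f x| < e).
  apply: contrapT => /forallNP nex; apply: nnear.
  apply/nbhs_normP; exists n.+1%:R^-1 => /=; first by rewrite invr_gt0.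
  move=> x /= hx; apply: contrapT => hf; exact: (nex x (conj hx hf)).
have [u hu] := choice ex.
have cu : u n @[n --> \oo] --> p.
  apply/cvgrPdist_lt => d d0; near=> n.
  have [h _] := hu n; apply: (lt_trans h).
  by near: n; exact: near_infty_natSinv_lt (PosNum d0).
have /cvgrPdist_lt/(_ e e0) [N _ hN] := H u cu.
by have [_] := hu N; apply; apply: hN => /=.
Unshelve. all: by end_near. Qed.

Lemma int1_continuous (V : normedModType R) (Phi : V -> R -> R) (M : R) :
  (forall t, continuous (Phi^~ t)) -> (forall x, measurable_fun setT (Phi x)) ->
  (forall x t, `|Phi x t| <= M / oneDsqr t) ->
  continuous (fun x => \int[mu]_t Phi x t).
Proof.
move=> c1 c2 hM p; apply: cvg_seqP => u cu.
apply: (@int1_cvg (fun n => Phi (u n)) (Phi p) M) => //.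
by move=> t; apply: (cvg_comp u (Phi^~ t) cu); exact: c1.
Qed.

Lemma decay1D phi psi : decay1 phi -> decay1 psi -> decay1 (fun t => phi t + psi t).
Proof.
move=> [c1 [M1 h1]] [c2 [M2 h2]]; split.
  by move=> x; apply: cvgD; [exact: c1 | exact: c2].
exists (M1 + M2) => t; rewrite mulrDl (le_trans (ler_normD _ _)) //.
by rewrite lerD.
Qed.

Lemma decay1M phi psi (B : R) : decay1 phi -> continuous psi ->
  (forall t, `|psi t| <= B) -> decay1 (fun t => phi t * psi t).
Proof.
move=> [c1 [M1 h1]] c2 h2; split.
  by move=> x; apply: cvgM; [exact: c1 | exact: c2].
exists (M1 * B) => t; rewrite normrM mulrAC ler_pM //.
Qed.

Lemma decay1Z phi (a : R) : decay1 phi -> decay1 (fun t => a * phi t).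
Proof.
move=> [c1 [M1 h1]]; split.
  by move=> x; apply: cvgM; [exact: cvg_cst | exact: c1].
by exists (`|a| * M1) => t; rewrite normrM -mulrA ler_wpM2l.
Qed.

Lemma int1D phi psi : decay1 phi -> decay1 psi ->
  \int[mu]_t (phi t + psi t) = \int[mu]_t phi t + \int[mu]_t psi t.
Proof. by move=> h1 h2; apply: RintegralD => //; exact: decay1_integrable. Qed.

Lemma int1Z phi (a : R) : decay1 phi ->
  \int[mu]_t (a * phi t) = a * \int[mu]_t phi t.
Proof. by move=> h1; apply: RintegralZl => //; exact: decay1_integrable. Qed.

Lemma decay1_oneDsqrV (M : R) : decay1 (fun t => M / oneDsqr t).
Proof.
split; last first.
  by exists `|M| => t; rewrite normrM [X in _ * X]ger0_norm.
by move=> x; apply: cvgM; [exact: cvg_cst | exact: continuous_oneDsqrV].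
Qed.

(** Peetre's inequality: the difference of the two sides is a sum of nonnegative terms. *)
Lemma oneDsqr_shift (x a : R) : oneDsqr x <= 2 * oneDsqr a * oneDsqr (x + a).
Proof.
rewrite /oneDsqr -subr_ge0.
have -> : 2 * (1 + a ^+ 2) * (1 + (x + a) ^+ 2) - (1 + x ^+ 2) =
  1 + (x + 2 * a) ^+ 2 + 2 * (a ^+ 2 * (x + a) ^+ 2) by ring.
have := mulr_ge0 (sqr_ge0 a) (sqr_ge0 (x + a)).
by have := sqr_ge0 (x + 2 * a); lra.
Qed.

Lemma oneDsqrV_shift (x a : R) :
  (oneDsqr (x + a))^-1 <= 2 * oneDsqr a / oneDsqr x.
Proof.
rewrite ler_pdivlMr ?oneDsqr_gt0 // mulrC ler_pdivrMr ?oneDsqr_gt0 //.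
exact: oneDsqr_shift.
Qed.

Lemma oneDsqrV_scale (x a : R) : a != 0 ->
  (oneDsqr (a * x))^-1 <= (1 + a ^- 2) / oneDsqr x.
Proof.
move=> a0; have a2 : 0 < a ^+ 2 by rewrite exprn_even_gt0.
rewrite ler_pdivlMr ?oneDsqr_gt0 // mulrC ler_pdivrMr ?oneDsqr_gt0 //.
rewrite /oneDsqr -subr_ge0.
have -> : (1 + a ^- 2) * (1 + (a * x) ^+ 2) - (1 + x ^+ 2) =
  a ^- 2 + a ^+ 2 * x ^+ 2 by field.
apply: addr_ge0; first by rewrite invr_ge0 ltW.
by apply: mulr_ge0; exact: sqr_ge0.
Qed.

Lemma decay1_affine phi (a b : R) : decay1 phi -> a != 0 ->
  decay1 (fun t => phi (a * t + b)).
Proof.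
move=> [c [M hM]] a0; split.
  move=> x; apply: (@continuous_comp _ _ _ (fun t => a * t + b) phi); last exact: c.
  by apply: cvgD; [apply: cvgM; [exact: cvg_cst | exact: cvg_id] | exact: cvg_cst].
have M0 : 0 <= M.
  by have := le_trans (normr_ge0 _) (hM 0); rewrite pmulr_lge0 // invr_gt0 oneDsqr_gt0.
exists (M * (2 * oneDsqr b * (1 + a ^- 2))) => t.
apply: (le_trans (hM _)); rewrite -!mulrA ler_wpM2l //.
apply: (le_trans (oneDsqrV_shift _ _)); rewrite -mulrA ler_wpM2l //.
by rewrite ler_wpM2l ?oneDsqrV_scale // ltW // oneDsqr_gt0.
Qed.

(** The substitution rule applied here is for nonnegative integrands, so [phi] is split as
    [(phi + M / oneDsqr) - M / oneDsqr], both terms being nonnegative by the decay bound. *)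
Lemma int1_affine phi (a b : R) : decay1 phi -> 0 < a ->
  \int[mu]_t phi t = a * \int[mu]_t phi (a * t + b).
Proof.
move=> hphi a0.
have ge0 (G : R -> R) : continuous G -> (forall t, 0 <= G t) -> decay1 G ->
    \int[mu]_t G t = a * \int[mu]_t G (a * t + b).
  move=> cG G0 dG; rewrite -int1Z; last exact: decay1_affine (lt0r_neq0 a0).
  pose F (t : R) := a * t + b.
  have dF (x : R) : is_derive x 1 F a.
    rewrite /F; apply: is_derive_eq.
    by rewrite addr0 /GRing.scale /= mulr1.
  have F'E : F^`()%classic = cst a.
    by apply/funext => x; rewrite derive1E; have [_ ->] := dF x.
  rewrite /Rintegral (@increasing_ge0_integration_by_substitutionT _ F) //.
  - congr fine; apply: eq_integral => x _; congr EFin.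
    by rewrite F'E /= mulrC.
  - by move=> x y xy; rewrite /F ltrD2r ltr_pM2l.
  - by rewrite F'E; exact: cst_continuous.
  - by rewrite F'E; exact: is_cvg_cst.
  - by rewrite F'E; exact: is_cvg_cst.
  - apply/cvgrNyPle => A; near=> x.
    rewrite -lerBrDr mulrC -ler_pdivlMr //; near: x.
  - apply/cvgryPge => A; near=> x.
    rewrite -lerBlDr mulrC -ler_pdivrMr //; near: x.
have [cphi [M hM]] := hphi.
have dM := decay1_oneDsqrV M.
have dN : decay1 (fun t => -1 * (M / oneDsqr t)) by exact: decay1Z.
have dS : decay1 (fun t => phi t + M / oneDsqr t) by exact: decay1D.
have E1 : \int[mu]_t phi t =
    \int[mu]_t (phi t + M / oneDsqr t) + -1 * \int[mu]_t (M / oneDsqr t).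
  by rewrite -int1Z // -int1D //; apply: eq_Rintegral => t _; ring.
have E2 : \int[mu]_t phi (a * t + b) =
    \int[mu]_t (phi (a * t + b) + M / oneDsqr (a * t + b)) +
    -1 * \int[mu]_t (M / oneDsqr (a * t + b)).
  rewrite -int1Z; last exact: (decay1_affine b dM (lt0r_neq0 a0)).
  rewrite -int1D.
  - by apply: eq_Rintegral => t _; ring.
  - exact: (decay1_affine b dS (lt0r_neq0 a0)).
  - exact: (decay1_affine b dN (lt0r_neq0 a0)).
rewrite E1 E2 mulrDr [in RHS]mulrCA; congr (_ + -1 * _).
- apply: (ge0 _ dS.1) => // t.
  by have := hM t; have := ler_norm (- phi t); rewrite normrN; lra.
- apply: (ge0 _ dM.1) => // t; exact: le_trans (normr_ge0 _) (hM t).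
Unshelve. all: by end_near. Qed.

Lemma FTC_itv (phi h : R -> R) (a b : R) : a < b -> continuous phi ->
  (forall x : R, is_derive x 1 h (phi x)) ->
  \int[mu]_(t in `[a, b]) phi t = h b - h a.
Proof.
move=> ab cphi dh.
have ch : continuous h.
  move=> x; apply: differentiable_continuous; apply/derivable1_diffP.
  exact: (@ex_derive _ _ _ _ _ _ _ (dh x)).
rewrite /Rintegral (@continuous_FTC2 _ phi h) //.
- exact: continuous_subspaceT.
- split.
  + by move=> x _; exact: (@ex_derive _ _ _ _ _ _ _ (dh x)).
  + by apply: cvg_at_right_filter; exact: ch.
  + by apply: cvg_at_left_filter; exact: ch.
- by move=> x _; rewrite derive1E; exact: derive_val.
Qed.

(** Truncate to [[-(n+1), n+1]]: the fundamental theorem leaves boundary values of [h], which its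
    decay sends to 0. *)
Lemma int1_deriv0 (phi h : R -> R) : decay1 phi -> decay1 h ->
  (forall x : R, is_derive x 1 h (phi x)) -> \int[mu]_t phi t = 0.
Proof.
move=> [cphi [M hM]] [_ [N hN]] dh.
pose phi_ n := phi \_ `[- (n.+1%:R : R), n.+1%:R].
have c1 : (\int[mu]_t phi_ n t) @[n --> \oo] --> \int[mu]_t phi t.
  apply: (@int1_cvg phi_ phi M).
  - move=> n; apply/(measurable_restrictT _ _).1 => //.
    by apply: measurable_funTS; exact: continuous_measurable_fun.
  - move=> n t; rewrite /phi_ patchE; case: ifP => _ //.
    by rewrite normr0; exact: le_trans (normr_ge0 _) (hM t).
  - move=> t; apply: cvg_near_cst; near=> n.
    rewrite /phi_ patchE mem_set //= in_itv /= -ler_norml.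
    apply: (@le_trans _ _ n%:R); last by rewrite ler_nat.
    by near: n; exact: nbhs_infty_ger.
have E n : \int[mu]_t phi_ n t = h n.+1%:R - h (- n.+1%:R).
  rewrite -(@FTC_itv phi h) ?gtrN ?ltr0Sn //.
  by rewrite [RHS]Rintegral_mkcond.
have c2 : (\int[mu]_t phi_ n t) @[n --> \oo] --> (0 : R).
  rewrite (funext E).
  have h0 (k : nat -> R) : (forall n, oneDsqr (k n) >= n.+1%:R) ->
      h (k n) @[n --> \oo] --> (0 : R).
    move=> hk; apply/norm_cvg0P.
    apply: (@squeeze_cvgr _ _ _ _ (cst 0) (fun n => `|N| * harmonic n)).
    + apply: nearW => n; rewrite normr_ge0 /= (le_trans (hN _)) //.
      rewrite (le_trans (ler_wpM2r _ (ler_norm N))) //.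
      by rewrite ler_wpM2l // lef_pV2 ?posrE ?oneDsqr_gt0.
    + exact: cvg_cst.
    + rewrite -[X in _ --> X](mulr0 `|N|).
      by apply: cvgM; [exact: cvg_cst | exact: cvg_harmonic].
  have sq n : (n.+1%:R : R) <= n.+1%:R ^+ 2 by rewrite -natrX ler_nat expnS leq_pmulr.
  rewrite -[X in _ --> X](subr0 0).
  apply: cvgB; apply: h0 => n; rewrite /oneDsqr ?sqrrN; have := sq n; lra.
exact: (cvg_unique _ c1 c2).
Unshelve. all: by end_near. Qed.

(* Approximate [f] by freezing the first variable on a grid. *)
Lemma measurable_caratheodory (f : R -> R -> R) :
  (forall s, measurable_fun setT (f s)) -> (forall t, continuous (f^~ t)) ->
  measurable_fun [set: (measurableTypeR R * measurableTypeR R)%type]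
    (fun z => f z.1 z.2).
Proof.
move=> mf cf.
pose g n (s : R) : R := (Num.floor (n.+1%:R * s))%:~R / n.+1%:R.
apply: (@measurable_fun_cvg _ _ _ _ (fun n z => f (g n z.1) z.2)).
  move=> n _ B mB; rewrite setTI.
  pose F (k : int) := [set s : R | Num.floor (n.+1%:R * s) = k] `*`
    (f (k%:~R / n.+1%:R) @^-1` B).
  rewrite (_ : _ @^-1` _ = \bigcup_k F k); last first.
    apply/seteqP; split => [[s t] /= h|[s t] [k _ [/= hk h]] /=].
      by exists (Num.floor (n.+1%:R * s)).
    by rewrite /g hk.
  apply: countable_bigcupT_measurable => [|k]; first exact: countableP.
  apply: measurableX; last by rewrite -[X in measurable X]setTI; exact: mf.
  rewrite (_ : [set _ | _] =
      (fun s : R => n.+1%:R * s) @^-1` `[k%:~R, (k + 1)%:~R[); last first.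
    apply/seteqP; split => s /=; rewrite in_itv /=.
      by move=> <-; exact: floor_itv.
    exact: floor_def.
  rewrite -[X in measurable X]setTI.
  have mm : measurable_fun [set: R] (fun s : R => n.+1%:R * s).
    apply: continuous_measurable_fun => x.
    by apply: cvgM; [exact: cvg_cst | exact: cvg_id].
  by apply: mm => //; exact: measurable_itv.
move=> [s t] _ /=.
have cg : g n s @[n --> \oo] --> s.
  apply/cvgrPdist_le => e e0; near=> n.
  have n0 : 0 < n.+1%:R :> R by [].
  have /andP[h1 h2] := floor_itv (n.+1%:R * s).
  have -> : s - g n s = (n.+1%:R * s - (Num.floor (n.+1%:R * s))%:~R) / n.+1%:R.
    by rewrite /g; field; rewrite lt0r_neq0.
  rewrite normrM [X in _ * X]ger0_norm ?invr_ge0 //.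
  rewrite ger0_norm ?subr_ge0 //.
  apply: (@le_trans _ _ n.+1%:R^-1).
    rewrite ler_piMl ?invr_ge0 // lerBlDl.
    by move: h2; rewrite intrD; exact: ltW.
  apply: ltW; near: n; exact: near_infty_natSinv_lt (PosNum e0).
by apply: (cvg_comp (fun n => g n s) (f^~ t) cg); exact: cf.
Unshelve. all: by end_near. Qed.

(** The two variables are treated asymmetrically because the Fejer weight, which will sit in the
    second one, jumps at 0. *)
Lemma int1_fubini (f : R -> R -> R) (M : R) :
  (forall s, measurable_fun setT (f s)) -> (forall t, continuous (f^~ t)) ->
  (forall s t, `|f s t| <= M / oneDsqr s / oneDsqr t) ->
  \int[mu]_s \int[mu]_t f s t = \int[mu]_t \int[mu]_s f s t.
Proof.
move=> mf cf hM.
have mF := measurable_caratheodory mf cf.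
have i1 s : mu.-integrable setT (EFin \o f s).
  exact: (integrable_bound (mf s) (hM s)).
have i2 t : mu.-integrable setT (EFin \o f^~ t).
  apply: (@integrable_bound _ (M / oneDsqr t)).
    exact: continuous_measurable_fun.
  by move=> s; rewrite mulrAC.
have iF : (mu \x mu)%E.-integrable setT
    (fun z : measurableTypeR R * measurableTypeR R => (f z.1 z.2)%:E).
  apply/integrable12ltyP; first exact/measurable_EFinP.
  have iM := integrableZl measurableT (M * oneDsqrV_int) integrable_oneDsqrV.
  apply: (@le_lt_trans _ _ (\int[mu]_s ((M * oneDsqrV_int) / oneDsqr s)%:E)%E).
    apply: ge0_le_integral => //.
    - by move=> s _; exact: integral_ge0.
    - apply: (@measurable_fun_fubini_tonelli_F _ _ _ _ _ mu
        (fun z : measurableTypeR R * measurableTypeR R => `|(f z.1 z.2)%:E|%E)) => //.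
      by apply: measurableT_comp => //; exact/measurable_EFinP.
    - by apply/measurable_EFinP; exact: continuous_measurable_fun (decay1_oneDsqrV _).1.
    - move=> s _ /=.
      have iMs := integrableZl measurableT (M / oneDsqr s) integrable_oneDsqrV.
      apply: (@le_trans _ _ (\int[mu]_t (M / oneDsqr s / oneDsqr t)%:E)%E).
        apply: ge0_le_integral => //.
        + by apply/measurable_EFinP; apply: measurableT_comp => //; exact: mf.
        + by apply/measurable_EFinP; exact: continuous_measurable_fun (decay1_oneDsqrV _).1.
        + by move=> t _; rewrite lee_fin.
      rewrite -[leLHS]fineK; last exact: integrable_fin_num iMs.
      rewrite lee_fin -/(Rintegral mu setT (fun t => M / oneDsqr s / oneDsqr t)).
      rewrite int1Z; first by rewrite /oneDsqrV_int mulrAC.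
      split; last by exists 1 => t; rewrite mul1r ger0_norm.
      by move=> x; exact: continuous_oneDsqrV.
  by rewrite -[ltLHS]fineK ?ltry //; exact: integrable_fin_num iM.
have := Fubini iF => /= E.
rewrite /Rintegral.
have E1 s : (fine (\int[mu]_t (f s t)%:E))%:E = (\int[mu]_t (f s t)%:E)%E.
  by rewrite fineK //; exact: integrable_fin_num (i1 s).
have E2 t : (fine (\int[mu]_s (f s t)%:E))%:E = (\int[mu]_s (f s t)%:E)%E.
  by rewrite fineK //; exact: integrable_fin_num (i2 t).
transitivity (fine (\int[mu]_s \int[mu]_t (f s t)%:E)%E).
  by congr fine; apply: eq_integral => s _; rewrite E1.
by rewrite E; congr fine; apply: eq_integral => t _; rewrite E2.
Qed.

(** * The Fejer kernel and Fourier injectivity on the line *)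

(** The right half of the triangle function; its cosine transform is the Fejer kernel (1 - cos u) /
    u^2. The interval is open at 0 so that frequency 0, where nothing is assumed in [fourier_inj1],
    gets weight 0. *)
Definition fejer_weight (y : R) : R := ((fun z : R => 1 - z : R) \_ `]0, 1]) y.

Definition fejer (u : R) : R := \int[mu]_y (fejer_weight y * cos (y * u)).

Lemma fejer_weight_bound y : `|fejer_weight y| <= 2 / oneDsqr y.
Proof.
rewrite /fejer_weight patchE; case: ifP => [|_]; last first.
  by rewrite normr0 divr_ge0 // ltW // oneDsqr_gt0.
rewrite inE /= in_itv /= => /andP[y0 y1].
rewrite ger0_norm ?subr_ge0 // ler_pdivlMr ?oneDsqr_gt0 // /oneDsqr.
nra.
Qed.

Lemma measurable_fejer_weight : measurable_fun setT fejer_weight.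
Proof.
apply/(measurable_restrictT _ _).1 => //.
apply: measurable_funTS; apply: continuous_measurable_fun => x.
by apply: cvgB; [exact: cvg_cst | exact: cvg_id].
Qed.

Lemma continuous_cos_lin (u b : R) : continuous (fun y : R => cos (y * u + b)).
Proof.
move=> x; apply: continuous_comp; last exact: continuous_cos.
by apply: cvgD; [apply: cvgM; [exact: cvg_id | exact: cvg_cst] | exact: cvg_cst].
Qed.

Lemma cos_bound (x : R) : `|cos x| <= 1.
Proof. by rewrite ler_norml cos_geN1 cos_le1. Qed.

Lemma fejer_itv u : fejer u = \int[mu]_(y in `[0, 1]) ((1 - y) * cos (y * u)).
Proof.
have cu : continuous (fun y : R => (1 - y) * cos (y * u)).
  move=> x; apply: cvgM; first by apply: cvgB; [exact: cvg_cst | exact: cvg_id].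
  have := @continuous_cos_lin u 0 x.
  by under [X in continuous_at _ X]eq_fun do rewrite addr0.
rewrite -Rintegral_itv_obnd_cbnd; last first.
  apply: (@integrableS _ _ _ mu `[0, 1]) => //.
    by apply: subset_itvr; rewrite bnd_simp.
  apply: continuous_compact_integrable; first exact: segment_compact.
  exact: continuous_subspaceT.
rewrite Rintegral_mkcond; apply: eq_Rintegral => y _.
by rewrite /fejer_weight !patchE; case: ifP => // _; rewrite mul0r.
Qed.

Lemma is_derive_lin (u b x : R) : is_derive x 1 (fun y : R => y * u + b) u.
Proof.
apply: is_derive_eq.
by rewrite scaler0 add0r addr0 /GRing.scale /= mulr1.
Qed.

Lemma is_derive_sin_lin (u b x : R) :
  is_derive x 1 (fun y : R => sin (y * u + b)) (u * cos (x * u + b)).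
Proof.
rewrite mulrC; exact: (@is_derive1_comp _ sin _ _ _ _ _ (is_derive_lin u b x)).
Qed.

Lemma is_derive_cos_lin (u b x : R) :
  is_derive x 1 (fun y : R => cos (y * u + b)) (- u * sin (x * u + b)).
Proof.
rewrite mulNr mulrC -mulNr.
exact: (@is_derive1_comp _ cos _ _ _ _ _ (is_derive_lin u b x)).
Qed.

Lemma fejerE u : u != 0 -> fejer u = (1 - cos u) / u ^+ 2.
Proof.
move=> u0; rewrite fejer_itv.
(* Antiderivative found by integrating by parts once; the phase [+ 0] gives the terms the shape of
   [is_derive_sin_lin] and [is_derive_cos_lin]. *)
pose h y : R := (1 - y) * (sin (y * u + 0) / u) - cos (y * u + 0) / u ^+ 2.
have ds := is_derive_sin_lin u 0.
have dc := is_derive_cos_lin u 0.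
have dh (x : R) : is_derive x 1 h ((1 - x) * cos (x * u)).
  rewrite /h; apply: is_derive_eq.
  by rewrite /GRing.scale /= !addr0; field.
rewrite (FTC_itv ltr01 _ dh).
  by rewrite /h !mul0r !mul1r !addr0 sin0 cos0; field.
move=> x; apply: cvgM; first by apply: cvgB; [exact: cvg_cst | exact: cvg_id].
have := @continuous_cos_lin u 0 x.
by under [X in continuous_at _ X]eq_fun do rewrite addr0.
Qed.

Lemma fejer_weight_ge0 y : 0 <= fejer_weight y.
Proof.
rewrite /fejer_weight patchE; case: ifP => //.
by rewrite inE /= in_itv /= subr_ge0 => /andP[].
Qed.

Lemma measurable_fejer_integrand u :
  measurable_fun setT (fun y => fejer_weight y * cos (y * u)).
Proof.
apply: measurable_funM; first exact: measurable_fejer_weight.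
apply: continuous_measurable_fun => x.
have := @continuous_cos_lin u 0 x.
by under [X in continuous_at _ X]eq_fun do rewrite addr0.
Qed.

Lemma fejer_integrand_bound u y :
  `|fejer_weight y * cos (y * u)| <= 2 / oneDsqr y.
Proof.
rewrite normrM -[leRHS]mulr1 ler_pM ?fejer_weight_bound ?cos_bound //.
Qed.

Lemma fejer_ge0 u : 0 <= fejer u.
Proof.
have [->|u0] := eqVneq u 0.
  apply: Rintegral_ge0 => y _.
  by rewrite mulr0 cos0 mulr1 fejer_weight_ge0.
by rewrite fejerE // divr_ge0 ?sqr_ge0 // subr_ge0 cos_le1.
Qed.

Lemma decay1_fejer : decay1 fejer.
Proof.
split.
  apply: (@int1_continuous _ (fun u y => fejer_weight y * cos (y * u)) 2).
  - move=> y u; apply: cvgM; first exact: cvg_cst.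
    have := @continuous_cos_lin y 0 u.
    by under [X in continuous_at _ X]eq_fun do rewrite addr0 mulrC.
  - exact: measurable_fejer_integrand.
  - exact: fejer_integrand_bound.
(* The summands [1] and [u ^+ 2] of [oneDsqr u] are handled separately: the first gives the bound on
   the integral, the second uses [u ^+ 2 * fejer u = 1 - cos u <= 2]. *)
exists (2 * oneDsqrV_int + 2) => u.
rewrite ler_pdivlMr ?oneDsqr_gt0 // /oneDsqr mulrDr mulr1 lerD //.
  apply: le_int1 (measurable_fejer_integrand u) _.
  exact: fejer_integrand_bound.
have [->|u0] := eqVneq u 0; first by rewrite expr0n mulr0.
rewrite fejerE // normrM mulrAC -mulrA.
have u2 : 0 < u ^+ 2 by rewrite exprn_even_gt0.
rewrite [X in X * _]ger0_norm ?subr_ge0 ?cos_le1 //.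
rewrite [X in _ * (_ * X)]ger0_norm ?invr_ge0 ?(ltW u2) //.
rewrite mulfV ?expf_neq0 // mulr1; have := cos_geN1 u; lra.
Qed.

(** Positivity of the mass is what allows cancelling it at the end of [fourier_inj1]; since the
    kernel is nonnegative, a lower bound on one interval suffices. *)
Lemma int_fejer_gt0 : 0 < \int[mu]_u fejer u.
Proof.
(* On [[1, 2]], contained in [[0, pi]], cosine decreases, so [1 - cos u >= 1 - cos 1], and
   [u ^+ 2 <= 4]. *)
pose c : R := (1 - cos 1) / 4.
have pi2 : (2 : R) <= pi by exact: pi_ge2.
have c0 : 0 < c.
  rewrite /c divr_gt0 // subr_gt0 -[ltRHS](@cos0 R) ltr_cos // in_itv /=; lra.
have lec u : 1 <= u -> u <= 2 -> c <= fejer u.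
  move=> u1 u2; have u0 : u != 0 by apply: lt0r_neq0; lra.
  rewrite fejerE // /c; apply: ler_pM => //.
  - rewrite lerD2l lerN2 leNgt ltr_cos ?in_itv /= -?leNgt //; lra.
  - rewrite lef_pV2 ?posrE //; nra.
pose psi := (cst c) \_ (`[1, 2] : set R).
have mpsi : measurable_fun setT psi.
  by apply/(measurable_restrictT _ _).1 => //; exact: measurable_cst.
have psiE u : psi u <= fejer u.
  rewrite /psi patchE; case: ifP => [|_]; last exact: fejer_ge0.
  by rewrite inE /= in_itv /= => /andP[]; exact: lec.
have psi0 u : 0 <= psi u.
  by rewrite /psi patchE; case: ifP => // _; exact: ltW.
have [_ [M hM]] := decay1_fejer.
have : \int[mu]_u psi u <= \int[mu]_u fejer u.
  apply: le_Rintegral => //; last exact: decay1_integrable decay1_fejer.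
  apply: (@integrable_bound _ M) => // u; apply: le_trans (hM u).
  by rewrite !ger0_norm // fejer_ge0.
apply: lt_le_trans.
rewrite -Rintegral_mkcond Rintegral_cst //.
have E : mu (`[1, 2] : set R) = 1%:E.
  rewrite lebesgue_measure_itv /= lte_fin ifT; last by rewrite ltr1n.
  by rewrite -EFinD; congr EFin; ring.
by rewrite (_ : fine _ = 1) ?mulr1 //; exact: (congr1 fine E).
Qed.

(* Testing [g] against the rescaled Fejer kernel gives [0] by Fubini; the kernel
   is an approximate identity. *)
Lemma fourier_inj1 (g : R -> R) : decay1 g ->
  (forall y b : R, y != 0 -> \int[mu]_t (g t * cos (t * y + b)) = 0) ->
  forall x, g x = 0.
Proof.
move=> dg hg x.
have [cg [M hM]] := dg.
have M0 : 0 <= M.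
  by have := le_trans (normr_ge0 _) (hM 0); rewrite pmulr_lge0 // invr_gt0 oneDsqr_gt0.
have gb t : `|g t| <= M.
  by apply: (le_trans (hM t)); rewrite ler_piMr // invf_le1 ?oneDsqr_gt0.
have [ck [K hK]] := decay1_fejer.
have kb u : `|fejer u| <= K.
  have K0 : 0 <= K.
    by have := le_trans (normr_ge0 _) (hK 0); rewrite pmulr_lge0 // invr_gt0 oneDsqr_gt0.
  by apply: (le_trans (hK u)); rewrite ler_piMr // invf_le1 ?oneDsqr_gt0.
(* After exchanging the integrals, the inner one is a Fourier integral of [g] at frequency [y * l]
   with phase [y * b]: zero by hypothesis if [y != 0], while for [y = 0] the weight vanishes. *)
have zero l b : l != 0 -> \int[mu]_t (g t * fejer (l * t + b)) = 0.
  move=> l0.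
  pose f t y := g t * (fejer_weight y * cos (y * (l * t + b))).
  transitivity (\int[mu]_t \int[mu]_y f t y).
    apply: eq_Rintegral => t _; rewrite RintegralZl //.
    apply: integrable_bound (measurable_fejer_integrand _) _.
    exact: fejer_integrand_bound.
  rewrite (@int1_fubini f (M * 2)).
  - transitivity (\int[mu]_(y in [set: R]) (0 : R)).
      apply: eq_Rintegral => y _.
      transitivity (\int[mu]_t (fejer_weight y * (g t * cos (t * (y * l) + y * b)))).
        apply: eq_Rintegral => t _; rewrite /f mulrCA; congr (_ * (_ * cos _)); ring.
      rewrite int1Z; last first.
        apply: (@decay1M _ _ 1 dg); first exact: continuous_cos_lin.
        by move=> t; exact: cos_bound.
      have [->|y0] := eqVneq y 0.
        by rewrite /fejer_weight patchE memNset ?mul0r //= in_itv /= ltxx.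
      by rewrite hg ?mulr0 // mulf_neq0.
    by rewrite Rintegral_cst // mul0r.
  - move=> t; apply: measurable_funM; first exact: measurable_cst.
    exact: measurable_fejer_integrand.
  - move=> y t; apply: cvgM; first exact: cg.
    apply: cvgM; first exact: cvg_cst.
    suff : continuous (fun t => cos (y * (l * t + b))) by exact.
    rewrite (_ : (fun _ => _) = (fun t => cos (t * (y * l) + y * b))).
      exact: continuous_cos_lin.
    by apply/funext => z; congr cos; ring.
  - move=> t y; rewrite /f normrM.
    apply: le_trans (ler_pM _ _ (hM t) (fejer_integrand_bound _ _)) _ => //.
    by rewrite le_eqVlt; apply/orP; left; apply/eqP; ring.
(* The substitution [a * t + x] moves the dilation from the kernel to [g]; as [a] tends to 0 the
   integrand then tends to [g x * fejer t] under a fixed majorant. *)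
have scaled a : 0 < a -> \int[mu]_t (g (a * t + x) * fejer t) = 0.
  move=> a0; have a1 : a != 0 by rewrite lt0r_neq0.
  have dG : decay1 (fun t => g t * fejer (a^-1 * t + - (a^-1 * x))).
    apply: (@decay1M _ _ K dg) => //.
    by have [] := decay1_affine (- (a^-1 * x)) decay1_fejer (invr_neq0 a1).
  have := zero a^-1 (- (a^-1 * x)) (invr_neq0 a1).
  rewrite (int1_affine x dG a0) => /eqP.
  rewrite mulf_eq0 (negbTE a1) /= => /eqP E.
  rewrite -[RHS]E; apply: eq_Rintegral => t _; congr (_ * fejer _).
  by field.
have cvg0 : (\int[mu]_t (g (n.+1%:R^-1 * t + x) * fejer t)) @[n --> \oo] -->
    \int[mu]_t (g x * fejer t).
  apply: (@int1_cvg _ _ (M * K)).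
  - move=> n; apply: continuous_measurable_fun => t.
    apply: cvgM; last exact: ck.
    have n0 : n.+1%:R^-1 != 0 :> R by rewrite invr_neq0 // pnatr_eq0.
    by have [c _] := decay1_affine x dg n0; exact: c.
  - by move=> n t; rewrite normrM -mulrA ler_pM.
  - move=> t; apply: cvgM; last exact: cvg_cst.
    suff cx : (fun n : nat => n.+1%:R^-1 * t + x) n @[n --> \oo] --> x.
      by apply: (cvg_comp (fun n : nat => n.+1%:R^-1 * t + x) g cx); exact: cg.
    rewrite -[X in _ --> X]add0r; apply: cvgD; last exact: cvg_cst.
    rewrite -[X in _ --> X](mul0r t); apply: cvgM; last exact: cvg_cst.
    exact: cvg_harmonic.
have : \int[mu]_t (g x * fejer t) = 0.
  apply: (cvg_unique _ cvg0) => //=.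
  rewrite (_ : (fun n : nat => _) = cst 0); first exact: cvg_cst.
  by apply/funext => n; rewrite scaled ?invr_gt0.
rewrite int1Z; last exact: decay1_fejer.
move/eqP; rewrite mulf_eq0 (gt_eqF int_fejer_gt0) orbF => /eqP; exact.
Qed.

End OneDim.

Section ContFun.
Context {K : numFieldType} {W : normedModType K} {T : topologicalType}.
Lemma cont_funD (f g : T -> W) : continuous f -> continuous g ->
  continuous (fun x => f x + g x).
Proof. by move=> cf cg x; apply: (@cvgD _ _ _ (nbhs x)); [exact: cf|exact: cg]. Qed.
Lemma cont_funB (f g : T -> W) : continuous f -> continuous g ->
  continuous (fun x => f x - g x).
Proof. by move=> cf cg x; apply: (@cvgB _ _ _ (nbhs x)); [exact: cf|exact: cg]. Qed.
Lemma cont_funZ (k : T -> K) (f : T -> W) : continuous k -> continuous f ->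
  continuous (fun x => k x *: f x).
Proof. by move=> cf cg x; apply: (@cvgZ _ _ _ (nbhs x)); [exact: cf|exact: cg]. Qed.
Lemma cont_funM (f g : T -> K) : continuous f -> continuous g ->
  continuous (fun x => f x * g x).
Proof. by move=> cf cg x; apply: (@cvgM _ _ (nbhs x)); [exact: cf|exact: cg]. Qed.
End ContFun.
Lemma cont_comp (S T U : topologicalType) (f : S -> T) (g : T -> U) :
  continuous f -> continuous g -> continuous (fun x => g (f x)).
Proof. by move=> cf cg x; apply: (@continuous_comp _ _ _ f g); [exact: cf | exact: cg]. Qed.

(** * Iterated integrals and the Fourier transform on R^n *)

Section Iterated.
Context {R : realType} {n : nat}.
Notation mu := (@lebesgue_measure R).
Notation V := 'rV[R]_n.
Implicit Types (x y : V) (i j : 'I_n) (l : seq 'I_n) (g h : V -> R).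

(** Written as a displacement along the basis vector, so that the derivative in [t] is the
    directional derivative in [pderiv]. *)
Definition set_coord x i (t : R) : V := x + (t - x 0 i) *: delta_mx 0 i.

Lemma set_coordE x i t j : set_coord x i t 0 j = if j == i then t else x 0 j.
Proof.
rewrite /set_coord !mxE eqxx /=; case: eqVneq => [->|_] /=; ring.
Qed.

Lemma set_coordC x i j s t : i != j ->
  set_coord (set_coord x i s) j t = set_coord (set_coord x j t) i s.
Proof.
move=> ij; apply/rowP => k; rewrite !set_coordE.
by case: (eqVneq k j) => // ->; rewrite eq_sym (negbTE ij).
Qed.

Lemma set_coord_id x i : set_coord x i (x 0 i) = x.
Proof. by rewrite /set_coord subrr scale0r addr0. Qed.

Lemma continuous_set_coordl i t : continuous (fun x => set_coord x i t).
Proof.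
rewrite /set_coord; apply: cont_funD; first by move=> x; exact: cvg_id.
apply: cont_funZ; last exact: cst_continuous.
by apply: cont_funB; [exact: cst_continuous | exact: coord_continuous].
Qed.
Lemma continuous_set_coordr x i : continuous (set_coord x i).
Proof.
apply: cont_funD; first exact: cst_continuous.
apply: cont_funZ; last exact: cst_continuous.
by apply: cont_funB; [move=> y; exact: cvg_id | exact: cst_continuous].
Qed.

(** The list may repeat a coordinate: repetition encodes a higher power, as in [weight_nseq_cat]. *)
Definition weight l x : R := \prod_(i <- l) oneDsqr (x 0 i).

Lemma weight_gt0 l x : 0 < weight l x.
Proof. by apply: prodr_gt0 => i _; exact: oneDsqr_gt0. Qed.

Lemma weight_ge1 l x : 1 <= weight l x.
Proof. by rewrite /weight; elim/big_ind: _ => // a b; exact: mulr_ege1. Qed.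

Lemma weight_cons i l x : weight (i :: l) x = oneDsqr (x 0 i) * weight l x.
Proof. by rewrite /weight big_cons. Qed.

Lemma weight_set_coord i l x t : i \notin l -> weight l (set_coord x i t) = weight l x.
Proof.
move=> il; apply: eq_big_seq => j jl; rewrite set_coordE.
by case: eqP => // ji; rewrite -ji jl in il.
Qed.

Lemma weight_perm l l' x : perm_eq l l' -> weight l x = weight l' x.
Proof. exact: perm_big. Qed.

(** Decay in the coordinates of [l], uniformly in the remaining ones; each integration consumes one
    element of the list. *)
Definition decay l h := continuous h /\ exists M : R, forall x, `|h x| <= M / weight l x.

Lemma decay_perm l l' h : perm_eq l l' -> decay l h -> decay l' h.
Proof.
move=> ll' [ch [M hM]]; split=> //; exists M => x.
by rewrite -(weight_perm _ ll').
Qed.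

Lemma decayD l g h : decay l g -> decay l h -> decay l (fun x => g x + h x).
Proof.
move=> [cg [M hM]] [ch [N hN]]; split.
  exact: cont_funD.
exists (M + N) => x; rewrite mulrDl (le_trans (ler_normD _ _)) //.
by rewrite lerD.
Qed.

Lemma decayM l g h (B : R) : decay l g -> continuous h -> (forall x, `|h x| <= B) ->
  decay l (fun x => g x * h x).
Proof.
move=> [cg [M hM]] ch hB; split.
  exact: cont_funM.
by exists (M * B) => x; rewrite normrM mulrAC ler_pM.
Qed.

Lemma decayZ l h (a : R) : decay l h -> decay l (fun x => a * h x).
Proof.
move=> [ch [M hM]]; split.
  by apply: cont_funM; [exact: cst_continuous | exact: ch].
by exists (`|a| * M) => x; rewrite normrM -mulrA ler_wpM2l.
Qed.

Lemma decay0 l : decay l (fun=> 0).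
Proof.
split; first exact: cst_continuous.
by exists 0 => x; rewrite normr0 mul0r.
Qed.

Lemma decay_sum (I : Type) (r : seq I) (F : I -> V -> R) l :
  (forall a, decay l (F a)) -> decay l (fun x => \sum_(a <- r) F a x).
Proof.
move=> hF; elim: r => [|a r IH].
  by under eq_fun do rewrite big_nil; exact: decay0.
by under eq_fun do rewrite big_cons; exact: decayD.
Qed.

(* Integration in the [i]-th coordinate, kept as an operator on functions of all
   coordinates; there is no Lebesgue measure on ['rV[R]_n] in the library, and
   [pints (enum 'I_n) h], which is constant, plays the role of the integral. *)
Definition pint i h x : R := \int[mu]_t h (set_coord x i t).

Lemma decay_line i l h x : i \notin l -> decay (i :: l) h ->
  decay1 (fun t => h (set_coord x i t)).
Proof.
move=> il [ch [M hM]]; split.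
  by apply: cont_comp; [exact: continuous_set_coordr | exact: ch].
exists (M / weight l x) => t; apply: (le_trans (hM _)).
by rewrite weight_cons set_coordE eqxx weight_set_coord // invfM mulrA mulrAC.
Qed.

Lemma le_pint i l h x (M : R) : i \notin l -> continuous h ->
  (forall x, `|h x| <= M / weight (i :: l) x) ->
  `|pint i h x| <= M * oneDsqrV_int / weight l x.
Proof.
move=> il ch hM; rewrite mulrAC; apply: le_int1.
  apply: continuous_measurable_fun.
  by apply: cont_comp; [exact: continuous_set_coordr | exact: ch].
move=> t; apply: (le_trans (hM _)).
by rewrite weight_cons set_coordE eqxx weight_set_coord // invfM mulrA mulrAC.
Qed.

Lemma decay_pint i l h : i \notin l -> decay (i :: l) h -> decay l (pint i h).
Proof.
move=> il [ch [M hM]]; split; last by exists (M * oneDsqrV_int) => x; exact: le_pint.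
have M0 : 0 <= M.
  by have := le_trans (normr_ge0 _) (hM 0); rewrite pmulr_lge0 // invr_gt0 weight_gt0.
(* Dominated convergence in [x] needs a majorant free of [x], so the factor [weight l x >= 1] is
   given up here. *)
apply: (@int1_continuous _ _ (fun x t => h (set_coord x i t)) M).
- by move=> t; apply: cont_comp; [exact: continuous_set_coordl | exact: ch].
- move=> x; apply: continuous_measurable_fun.
  by apply: cont_comp; [exact: continuous_set_coordr | exact: ch].
- move=> x t; apply: (le_trans (hM _)).
  rewrite weight_cons set_coordE eqxx ler_wpM2l // lef_pV2;
    rewrite ?posrE ?mulr_gt0 ?oneDsqr_gt0 ?weight_gt0 //.
  rewrite ler_peMr ?weight_ge1 // ltW ?oneDsqr_gt0 //.
Qed.

Definition pints l h : V -> R := foldr pint h l.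

Lemma decay_catl l l' h : decay (l ++ l') h -> decay l h.
Proof.
move=> [ch [M hM]]; split => //; exists M => x; apply: (le_trans (hM x)).
have M0 : 0 <= M.
  by have := le_trans (normr_ge0 _) (hM 0); rewrite pmulr_lge0 // invr_gt0 weight_gt0.
rewrite ler_wpM2l // lef_pV2 ?posrE ?weight_gt0 // {2}/weight big_cat /=.
by rewrite ler_peMr ?weight_ge1 // ltW ?weight_gt0.
Qed.

Lemma decay_cons i l h : decay (i :: l) h -> decay l h.
Proof.
move=> hh; apply: (@decay_catl _ [:: i]); apply: decay_perm hh.
by rewrite cats1 perm_sym perm_rcons.
Qed.

Lemma decay_pints l l' h : uniq (l ++ l') -> decay (l ++ l') h -> decay l' (pints l h).
Proof.
elim: l l' => [//|i l IH] l' /= /andP[il u] d.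
have p : perm_eq (i :: l ++ l') (l ++ i :: l').
  by rewrite perm_sym (perm_catCA l [:: i] l').
have il' : i \notin l' by move: il; rewrite mem_cat negb_or => /andP[].
apply: decay_pint => //; apply: IH; last exact: decay_perm d.
by rewrite -(perm_uniq p) /= il.
Qed.

(** Unlike [decay_pints], this keeps the constant explicit, which gives the uniformity in [xi] of
    [FT_estimate]. *)
Lemma le_pints l l' h (M : R) : uniq (l ++ l') -> continuous h ->
  (forall x, `|h x| <= M / weight (l ++ l') x) ->
  forall x, `|pints l h x| <= M * oneDsqrV_int ^+ size l / weight l' x.
Proof.
elim: l l' => [|i l IH] l' /= u ch hM x; first by rewrite expr0 mulr1; exact: hM.
have p : perm_eq (i :: l ++ l') (l ++ i :: l').
  by rewrite perm_sym (perm_catCA l [:: i] l').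
have u' : uniq (l ++ i :: l') by rewrite -(perm_uniq p).
have hM' z : `|h z| <= M / weight (l ++ i :: l') z by rewrite -(weight_perm _ p).
have il' : i \notin l'.
  by move: u => /andP[]; rewrite mem_cat negb_or => /andP[].
rewrite exprSr mulrA; apply: le_pint => //; last exact: IH.
by have [] := decay_pints u' (conj ch (ex_intro _ M hM')).
Qed.

Lemma pints_ext l g h : g =1 h -> pints l g =1 pints l h.
Proof. by move=> /funext ->. Qed.

Lemma pints0 l x : pints l (fun=> 0) x = 0.
Proof.
elim: l x => [//|i l IH] x /=; rewrite /pint (funext IH).
by rewrite Rintegral_cst // mul0r.
Qed.

Lemma pintsD l g h x : uniq l -> decay l g -> decay l h ->
  pints l (fun z => g z + h z) x = pints l g x + pints l h x.
Proof.
elim: l x => [//|i l IH] x /= /andP[il u] dg dh.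
have E z : pints l (fun z => g z + h z) z = pints l g z + pints l h z.
  by apply: IH => //; apply: (@decay_cons i).
have p f : decay (i :: l) f -> decay [:: i] (pints l f).
  move=> df; apply: decay_pints; first by rewrite cats1 rcons_uniq il.
  by apply: decay_perm df; rewrite cats1 perm_sym perm_rcons.
rewrite /pint (funext E) int1D //; apply: (@decay_line _ [::]) => //; exact: p.
Qed.

Lemma pintsZ l h a x : uniq l -> decay l h ->
  pints l (fun z => a * h z) x = a * pints l h x.
Proof.
elim: l x => [//|i l IH] x /= /andP[il u] dh.
have E z : pints l (fun z => a * h z) z = a * pints l h z.
  by apply: IH => //; apply: (@decay_cons i).
have p : decay [:: i] (pints l h).
  apply: decay_pints; first by rewrite cats1 rcons_uniq il.
  by apply: decay_perm dh; rewrite cats1 perm_sym perm_rcons.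
rewrite /pint (funext E) int1Z //; apply: (@decay_line _ [::]) => //; exact: p.
Qed.

Lemma pints_sum (I : Type) (r : seq I) (F : I -> V -> R) l x : uniq l ->
  (forall a, decay l (F a)) ->
  pints l (fun z => \sum_(a <- r) F a z) x = \sum_(a <- r) pints l (F a) x.
Proof.
move=> u hF; elim: r => [|a r IH].
  by rewrite big_nil -[RHS](pints0 l x); apply: pints_ext => z; rewrite big_nil.
rewrite big_cons -IH -pintsD //; last exact: decay_sum.
by apply: pints_ext => z; rewrite big_cons.
Qed.

Lemma pintC i j h x : i != j -> decay [:: i; j] h -> pint i (pint j h) x = pint j (pint i h) x.
Proof.
move=> ij [ch [M hM]]; rewrite /pint.
rewrite (@int1_fubini _ (fun s t => h (set_coord (set_coord x i s) j t)) M).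
- by apply: eq_Rintegral => t _; apply: eq_Rintegral => s _; rewrite set_coordC.
- move=> s; apply: continuous_measurable_fun.
  by apply: cont_comp; [exact: continuous_set_coordr | exact: ch].
- move=> t; apply: cont_comp; last exact: ch.
  exact: cont_comp (@continuous_set_coordr x i) (@continuous_set_coordl j t).
- move=> s t; apply: (le_trans (hM _)).
  rewrite !weight_cons /weight big_nil !set_coordE eqxx (negbTE ij) eqxx mulr1.
  by rewrite invfM mulrA.
Qed.

(** The head of the list is integrated last; successive swaps by [pintC] let it be integrated first,
    as integration by parts and the shear both require. *)
Lemma pints_pint i l h x : uniq (i :: l) -> decay (i :: l) h ->
  pints (i :: l) h x = pints l (pint i h) x.
Proof.
elim: l x => [//|j l IH] x u d.
have p : perm_eq [:: i, j & l] (l ++ [:: i; j]).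
  by rewrite perm_sym perm_catC.
have ij : i != j by move: u; rewrite /= inE negb_or => /andP[/andP[]].
have p2 : perm_eq [:: i, j & l] [:: j, i & l].
  by rewrite (perm_catCA [:: i] [:: j] l).
transitivity (pint j (pints (i :: l) h) x).
  rewrite /= pintC //; apply: decay_pints; last exact: decay_perm d.
  by rewrite -(perm_uniq p).
rewrite /=; congr (pint j _ x); apply/funext => z; apply: IH.
  by move: u; rewrite (perm_uniq p2) /= => /andP[].
by apply: (@decay_cons j); exact: decay_perm d.
Qed.

Lemma pints_rem i l h x : uniq l -> i \in l -> decay l h ->
  pints l h x = pints (rem i l) (pint i h) x.
Proof.
elim: l x => [//|j l IH] x u il d; rewrite [rem _ _]/=.
case: eqVneq => [E|ij]; first by rewrite -E in u d *; exact: pints_pint.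
rewrite /=; congr (pint j _ x); apply/funext => z; apply: IH.
- by case/andP: u.
- by move: il; rewrite inE eq_sym (negbTE ij).
- exact: decay_cons d.
Qed.

Lemma cont_sum (I : Type) (r : seq I) (F : I -> V -> R) :
  (forall a, continuous (F a)) -> continuous (fun x => \sum_(a <- r) F a x).
Proof.
move=> hF; elim: r => [|a r IH].
  rewrite (_ : (fun x => \sum_(a <- [::]) F a x) = cst 0).
    exact: cst_continuous.
  by apply/funext => x; rewrite big_nil.
rewrite (_ : (fun x => \sum_(b <- a :: r) F b x) =
    (fun x => F a x + \sum_(b <- r) F b x)); first exact: cont_funD.
by apply/funext => x; rewrite big_cons.
Qed.

Lemma dotpD x y z : dotp (x + y) z = dotp x z + dotp y z.
Proof. by rewrite /dotp -big_split; apply: eq_bigr => i _; rewrite mxE mulrDl. Qed.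

Lemma dotpZ a x y : dotp (a *: x) y = a * dotp x y.
Proof. by rewrite /dotp mulr_sumr; apply: eq_bigr => i _; rewrite mxE mulrA. Qed.

Lemma dotpC x y : dotp x y = dotp y x.
Proof. by apply: eq_bigr => i _; rewrite mulrC. Qed.

Lemma dotp_delta i y : dotp (delta_mx 0 i) y = y 0 i.
Proof.
rewrite /dotp (bigD1 i) //= big1; last first.
  by move=> j ji; rewrite mxE (negbTE ji) andbF mul0r.
by rewrite mxE !eqxx mul1r addr0.
Qed.

Lemma dotp_set_coord x i t y :
  dotp (set_coord x i t) y = t * y 0 i + (dotp x y - x 0 i * y 0 i).
Proof. rewrite /set_coord dotpD dotpZ dotp_delta; ring. Qed.

(* Shifting [b] by [pi / 2] turns cosines into sines, so letting [b] vary replaces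
   the complex exponential exp(i<x, y>) by real functions. *)
Definition phase y (b : R) x : R := cos (dotp x y + b).

Lemma continuous_phase y b : continuous (phase y b).
Proof.
apply: (@cont_comp _ _ _ (fun x => dotp x y + b) cos); last exact: continuous_cos.
apply: cont_funD; last exact: cst_continuous.
apply: cont_sum => i; apply: cont_funM; last exact: cst_continuous.
exact: coord_continuous.
Qed.

Lemma decay_phase l h y b : decay l h -> decay l (fun x => h x * phase y b x).
Proof.
move=> dh; apply: (@decayM _ _ _ 1 dh); first exact: continuous_phase.
by move=> x; exact: cos_bound.
Qed.

Lemma pint_deriv0 i h h' x : decay [:: i] h -> decay [:: i] h' ->
  (forall t : R, is_derive t 1 (fun t => h (set_coord x i t)) (h' (set_coord x i t))) ->
  pint i h' x = 0.
Proof. by move=> d d'; apply: int1_deriv0; apply: (@decay_line _ [::]). Qed.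

Lemma is_derive_set_coord h x i (t : R) : derivable h (set_coord x i t) (delta_mx 0 i) ->
  is_derive t 1 (fun t => h (set_coord x i t)) (pderiv i h (set_coord x i t)).
Proof.
have E : (fun s : R => s^-1 *: (h (set_coord x i (s *: 1 + t)) - h (set_coord x i t))) =
  (fun s : R => s^-1 *: (h (s *: delta_mx 0 i + set_coord x i t) - h (set_coord x i t))).
  apply/funext => s; congr (_ *: (h _ - _)).
  rewrite /set_coord addrCA -scalerDl; congr (_ + _ *: _).
  by rewrite /GRing.scale /= mulr1 addrA.
by move=> dh; split; rewrite /derivable /derive /= E.
Qed.

(** Integration by parts in coordinate [i], brought to the front by [pints_rem]: the derivative of
    [g * phase y b] integrates to zero, and the sine it produces is a cosine with phase lowered by
    pi / 2. *)
Lemma FT_pderiv l i g y b x : uniq l -> i \in l ->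
  (forall z, derivable g z (delta_mx 0 i)) -> decay l g -> decay l (pderiv i g) ->
  pints l (fun z => pderiv i g z * phase y b z) x =
  y 0 i * pints l (fun z => g z * phase y (b - pi / 2) z) x.
Proof.
move=> u il dg d d'.
have sinE a : cos (a + (b - pi / 2)) = sin (a + b).
  by rewrite addrA -[sin _](opprK) -cosDpihalf; rewrite cosBpihalf cosDpihalf opprK.
have dp := decay_phase y b d'.
have dq : decay l (fun z => - y 0 i * (g z * phase y (b - pi / 2) z)).
  by apply: decayZ; exact: decay_phase.
apply/eqP; rewrite -subr_eq0 -mulNr -pintsZ //; last exact: decay_phase.
rewrite -pintsD // (pints_rem _ u il); last exact: decayD.
rewrite (@pints_ext _ _ (fun=> 0)) ?pints0 // => z.
have il1 f : decay l f -> decay [:: i] f.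
  by move=> df; apply: (@decay_catl _ (rem i l)); apply: decay_perm df; exact: perm_to_rem.
apply: (@pint_deriv0 _ (fun z => g z * phase y b z)).
- by apply: il1; exact: decay_phase.
- by apply: il1; exact: decayD.
move=> t.
have d1 := is_derive_set_coord (dg (set_coord z i t)).
have d2 := is_derive_cos_lin (y 0 i) (dotp z y - z 0 i * y 0 i + b) t.
have E s : phase y b (set_coord z i s) =
    cos (s * y 0 i + (dotp z y - z 0 i * y 0 i + b)).
  by rewrite /phase dotp_set_coord -addrA.
have -> : (fun s : R => g (set_coord z i s) * phase y b (set_coord z i s)) =
  (fun s : R => g (set_coord z i s) * cos (s * y 0 i + (dotp z y - z 0 i * y 0 i + b))).
  by apply/funext => s; rewrite E.
apply: is_derive_eq.
have E' : sin (dotp (set_coord z i t) y + b) =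
    sin (t * y 0 i + (dotp z y - z 0 i * y 0 i + b)) by rewrite dotp_set_coord -addrA.
rewrite E /phase sinE E' /GRing.scale /=; ring.
Qed.

Lemma pints_ext_at i l g h x : i \notin l ->
  (forall z : V, z 0 i = x 0 i -> g z = h z) -> pints l g x = pints l h x.
Proof.
elim: l x => [|j l IH] x /=; first by move=> _ /(_ x erefl).
rewrite inE negb_or => /andP[ij il] E; apply: eq_Rintegral => t _.
by apply: IH => // z; rewrite set_coordE (negbTE ij); exact: E.
Qed.

Lemma pints_inv l h x x' : (forall i, i \notin l -> x 0 i = x' 0 i) ->
  pints l h x = pints l h x'.
Proof.
elim: l x x' => [|j l IH] x x' E /=.
  by congr h; apply/rowP => i; exact: E.
apply: eq_Rintegral => t _; apply: IH => i il; rewrite !set_coordE.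
by case: eqVneq => // ij; apply: E; rewrite inE negb_or ij.
Qed.

Lemma cosMcos (a b : R) : cos a * cos b = 2^-1 * cos (a + b) + 2^-1 * cos (a - b).
Proof. by rewrite cosD cosB; field. Qed.

(** Induction on the coordinates still transformed. With coordinate [i] frozen at [t], the transform
    in the others is a function of [t]. Its own transform at [eta] contains a product of two
    cosines, hence is a combination of full transforms at frequencies whose [i]-th coordinates are
    [eta] and [- eta], both nonzero. *)
Lemma FT_inj l h : uniq l -> decay l h ->
  (forall y b x, (forall i, y 0 i != 0) ->
    pints l (fun z => h z * phase y b z) x = 0) ->
  forall x, h x = 0.
Proof.
move=> u d; elim: l u d => [|i l IH].
  (* The phase is chosen so that the cosine equals 1 at [x]. *)
  move=> _ _ H x; have := H (const_mx 1) (- dotp x (const_mx 1)) x.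
  rewrite /= /phase subrr cos0 mulr1; apply=> i.
  by rewrite mxE oner_neq0.
move=> /= /andP[il u] d H; apply: (IH u); first exact: decay_cons d.
move=> y b x0 hy.
(* Removing the [i]-th frequency and absorbing its contribution at [x0] into the phase makes the
   oscillating factor independent of coordinate [i]. *)
pose y0 := set_coord y i 0.
pose b0 := x0 0 i * y 0 i + b.
transitivity (pints l (fun z => h z * phase y0 b0 z) x0).
  apply: (@pints_ext_at i) => // z zi; rewrite /phase; congr (_ * cos _).
  rewrite (dotpC _ y0) (dotpC _ y) dotp_set_coord zi /b0; ring.
suff A0 t : pints l (fun z => h z * phase y0 b0 z) (set_coord x0 i t) = 0.
  by rewrite -[x0 in LHS](set_coord_id x0 i).
have dl : decay l h by apply: decay_cons d.
have di : decay [:: i] (pints l (fun z => h z * phase y0 b0 z)).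
  apply: decay_pints; first by rewrite cats1 rcons_uniq il.
  by apply: decay_perm (decay_phase _ _ d); rewrite cats1 perm_sym perm_rcons.
move: t; apply: fourier_inj1; first exact: (@decay_line _ [::]).
move=> eta p eta0.
have E t : pints l (fun z => h z * phase y0 b0 z) (set_coord x0 i t) * cos (t * eta + p) =
   2^-1 * pints l (fun z => h z * phase (set_coord y i eta) (b0 + p) z) (set_coord x0 i t) +
   2^-1 * pints l (fun z => h z * phase (set_coord y i (- eta)) (b0 - p) z) (set_coord x0 i t).
  rewrite mulrC -!pintsZ //; try exact: decay_phase.
  rewrite -pintsD //; try by apply: decayZ; exact: decay_phase.
  apply: (@pints_ext_at i) => // z; rewrite set_coordE eqxx => zi.
  pose D := dotp y z - y 0 i * z 0 i.
  have pE s c : phase (set_coord y i s) c z = cos (D + c + t * s).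
    by rewrite /phase dotpC dotp_set_coord /D zi; congr cos; ring.
  rewrite /y0 !pE mulrCA [cos _ * _]mulrC cosMcos.
  rewrite (_ : D + (b0 + p) + t * eta = D + b0 + t * 0 + (t * eta + p)); last by ring.
  rewrite (_ : D + (b0 - p) + t * - eta = D + b0 + t * 0 - (t * eta + p)); last by ring.
  by ring.
rewrite (funext E).
have lin s c : decay1 (fun t =>
    pints l (fun z => h z * phase (set_coord y i s) c z) (set_coord x0 i t)).
  apply: (@decay_line _ [::]) => //.
  apply: decay_pints; first by rewrite cats1 rcons_uniq il.
  by apply: decay_perm (decay_phase _ _ d); rewrite cats1 perm_sym perm_rcons.
have Z s c : s != 0 ->
    \int[mu]_t pints l (fun z => h z * phase (set_coord y i s) c z) (set_coord x0 i t) = 0.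
  move=> s0; apply: (H (set_coord y i s) c x0) => j; rewrite set_coordE.
  by case: ifP.
rewrite int1D; try by apply: decay1Z; exact: lin.
by rewrite !int1Z ?Z ?oppr_eq0 // !mulr0 addr0.
Qed.

(** * Taylor remainder of the cosine, shears and the moment estimate *)

(** Taylor polynomial of [cos (c + v)] in [v]: the q-th derivative of cosine at [c] is cosine at
    [c + q * pi / 2]. *)
Definition cos_poly (k : nat) (c : R) : {poly R} :=
  \poly_(q < k) (cos (c + q%:R * (pi / 2)) / q`!%:R).

Lemma deriv_cos_poly k c : (cos_poly k.+1 c)^`() = cos_poly k (c + pi / 2).
Proof.
apply/polyP => q; rewrite coef_deriv !coef_poly ltnS; case: ifP => _; last exact: mul0rn.
rewrite factS natrM -mulrnAr; congr (_ * _).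
  by congr cos; rewrite -natr1; ring.
have q0 : (q.+1%:R : R) != 0 by rewrite pnatr_eq0.
have f0 : (q`!%:R : R) != 0 by rewrite pnatr_eq0 -lt0n fact_gt0.
by rewrite -mulr_natr invfM mulrAC mulVf // mul1r.
Qed.

(** Induction by the mean value theorem: the remainder vanishes at 0, and its derivative is the
    remainder of one order less with phase [c + pi / 2]. *)
Lemma cos_taylor k (c v : R) : `|cos (c + v) - (cos_poly k c).[v]| <= `|v| ^+ k.
Proof.
elim: k c v => [|k IH] c v.
  by rewrite /cos_poly poly_def big_ord0 horner0 subr0 expr0 cos_bound.
pose D w := cos (w * 1 + c) - (cos_poly k.+1 c).[w].
pose D' w := cos (c + pi / 2 + w) - (cos_poly k (c + pi / 2)).[w].
have dD (w : R) : is_derive w 1 D (D' w).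
  have dc := is_derive_cos_lin 1 c w.
  have dp := is_derive_poly (cos_poly k.+1 c) w.
  rewrite /D' -deriv_cos_poly.
  have -> : cos (c + pi / 2 + w) = - 1 * sin (w * 1 + c).
    by rewrite addrAC cosDpihalf mulN1r mulr1 addrC.
  exact: is_deriveB.
have cD : continuous D.
  move=> w; apply: differentiable_continuous; apply/derivable1_diffP.
  exact: (@ex_derive _ _ _ _ _ _ _ (dD w)).
have D0 : D 0 = 0.
  rewrite /D mul0r add0r horner_coef0 coef_poly /= mul0r addr0 fact0 divr1.
  exact: subrr.
have -> : cos (c + v) - (cos_poly k.+1 c).[v] = D v by rewrite /D mulr1 (addrC v).
have bD' w : `|w| <= `|v| -> `|D' w| <= `|v| ^+ k.
  by move=> wv; apply: (le_trans (IH _ _)); rewrite lerXn2r ?nnegrE.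
have wc a b : {within `[a, b], continuous D} by exact: continuous_subspaceT.
have [v0|v0] := leP 0 v.
  have [w] := MVT_segment v0 (fun w _ => dD w) (wc _ _).
  rewrite in_itv /= D0 !subr0 => /andP[w0 wv] ->.
  by rewrite normrM exprSr ler_wpM2r // bD' // !ger0_norm.
have [w] := MVT_segment (ltW v0) (fun w _ => dD w) (wc _ _).
rewrite in_itv /= D0 !sub0r => /andP[wv w0] /eqP.
rewrite eqr_oppLR => /eqP ->.
by rewrite normrN normrM normrN exprSr ler_wpM2r // bD' // !ler0_norm ?lerN2 // ltW.
Qed.

(* When [xi 0 i = 1], the shear maps lines parallel to the [i]-th axis to lines
   directed by [xi]. *)
Definition shear i (xi : V) x : V := x + x 0 i *: (xi - delta_mx 0 i).

Lemma shearE i (xi : V) x j : xi 0 i = 1 ->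
  shear i xi x 0 j = if j == i then x 0 i else x 0 j + x 0 i * xi 0 j.
Proof.
by move=> xi1; rewrite /shear !mxE eqxx /=; case: eqVneq => [->|_]; rewrite ?xi1 /=; ring.
Qed.

Lemma shear_line i (xi : V) x t : xi 0 i = 1 ->
  shear i xi (set_coord x i t) = set_coord x i 0 + t *: xi.
Proof.
move=> xi1; apply/rowP => j; rewrite shearE // !set_coordE eqxx [in RHS]mxE set_coordE mxE.
by case: eqVneq => [->|_]; rewrite ?xi1; ring.
Qed.

Lemma continuous_shear i (xi : V) : continuous (shear i xi).
Proof.
apply: cont_funD; first by move=> x; exact: cvg_id.
by apply: cont_funZ; [exact: coord_continuous | exact: cst_continuous].
Qed.

(** Since [i] is not integrated, the shear merely translates each coordinate [j] of [l] by the fixed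
    amount [x 0 i * xi 0 j]. *)
Lemma pints_shear l i (xi : V) g x : xi 0 i = 1 -> i \notin l -> uniq l -> decay l g ->
  pints l (fun z => g (shear i xi z)) x = pints l g (shear i xi x).
Proof.
move=> xi1; elim: l x => [//|j l IH] x /=.
rewrite inE negb_or => /andP[ij il] /andP[jl u] d.
rewrite /pint (_ : (fun t => _) = (fun t =>
    pints l g (set_coord (shear i xi x) j (1 * t + x 0 i * xi 0 j)))).
  rewrite -[LHS]mul1r -(@int1_affine _ (fun t => pints l g (set_coord (shear i xi x) j t))) //.
  apply: (@decay_line _ [::]) => //; apply: decay_pints; first by rewrite cats1 rcons_uniq jl.
  by apply: decay_perm d; rewrite cats1 perm_sym perm_rcons.
apply/funext => t; rewrite IH //; last exact: decay_cons d.
congr (pints l g _); apply/rowP => k.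
rewrite shearE // !set_coordE shearE // (negbTE ij) mul1r.
have [->|kj] := eqVneq k j; last by [].
by rewrite eq_sym (negbTE ij).
Qed.

(** A change of variables of determinant 1, after which the first integration runs along lines
    directed by [xi]. The base point moved by the shear is immaterial: [l] contains every coordinate
    except [i], which the shear fixes. *)
Lemma pints_shear_all l i (xi : V) g x : xi 0 i = 1 -> uniq (i :: l) ->
  (forall j, j != i -> j \in l) -> decay (i :: l) g ->
  decay (i :: l) (fun z => g (shear i xi z)) ->
  pints (i :: l) g x = pints l (pint i (fun z => g (shear i xi z))) x.
Proof.
move=> xi1 u al d d'; rewrite -pints_pint //=; apply: eq_Rintegral => t _.
have /andP[il ul] := u.
rewrite pints_shear //; last exact: decay_cons d.
apply: pints_inv => j jl; have ji : j = i.
  by apply/eqP; apply: contraNT jl; exact: al.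
by rewrite ji shearE // eqxx.
Qed.

Lemma decay1_sum (I : Type) (r : seq I) (F : I -> R -> R) :
  (forall a, decay1 (F a)) -> decay1 (fun t => \sum_(a <- r) F a t).
Proof.
move=> hF; elim: r => [|a r IH].
  rewrite (_ : (fun t => _) = (fun t : R => 0 / oneDsqr t)).
    exact: decay1_oneDsqrV.
  by apply/funext => t; rewrite big_nil mul0r.
rewrite (_ : (fun t => _) = (fun t => F a t + \sum_(b <- r) F b t)).
  exact: decay1D.
by apply/funext => t; rewrite big_cons.
Qed.

Lemma int1_sum0 (I : Type) (r : seq I) (F : I -> R -> R) :
  (forall a, decay1 (F a)) -> (forall a, \int[mu]_t F a t = 0) ->
  \int[mu]_t (\sum_(a <- r) F a t) = 0.
Proof.
move=> hF hF0; elim: r => [|a r IH].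
  rewrite (_ : (fun t => _) = (fun t : R => 0)); first by rewrite Rintegral_cst // mul0r.
  by apply/funext => t; rewrite big_nil.
rewrite (_ : (fun t => _) = (fun t => F a t + \sum_(b <- r) F b t)).
  by rewrite int1D ?hF0 ?IH ?addr0 //; exact: decay1_sum.
by apply/funext => t; rewrite big_cons.
Qed.

Lemma exprn_le_oneDsqr (t : R) (q K : nat) : (q <= K)%N ->
  `|t| ^+ q <= oneDsqr t ^+ K.
Proof.
move=> qK; apply: (@le_trans _ _ (oneDsqr t ^+ q)).
  rewrite lerXn2r ?nnegrE // ?(ltW (oneDsqr_gt0 _)) //.
  by rewrite /oneDsqr -real_normK ?num_real //; have := sqr_ge0 (`|t| - 1); nra.
by rewrite ler_weXn2l.
Qed.

Lemma continuous_cos_affine (c s : R) : continuous (fun t : R => cos (c + t * s)).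
Proof.
rewrite (_ : (fun t : R => cos (c + t * s)) = (fun t => cos (t * s + c))).
  exact: continuous_cos_lin.
by apply/funext => t; rewrite addrC.
Qed.

Lemma pow_decay (G : R -> R) (A : R) (K q : nat) (t : R) : (q <= K)%N ->
  `|G t| <= A / oneDsqr t ^+ K.+1 -> `|t ^+ q * G t| <= A / oneDsqr t.
Proof.
move=> qK hG; rewrite normrM normrX.
apply: (le_trans (ler_pM _ _ (exprn_le_oneDsqr t qK) hG)); rewrite ?exprn_ge0 //.
have t0 := lt0r_neq0 (oneDsqr_gt0 t).
have tK : oneDsqr t ^+ K != 0 by rewrite expf_neq0.
by rewrite exprS le_eqVlt; apply/orP; left; apply/eqP; field; rewrite t0.
Qed.

Lemma decay1_pow (G : R -> R) (A : R) (K q : nat) : continuous G -> (q <= K)%N ->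
  (forall t, `|G t| <= A / oneDsqr t ^+ K.+1) -> decay1 (fun t => t ^+ q * G t).
Proof.
move=> cG qK hG; split; last by exists A => t; exact: (pow_decay qK (hG t)).
apply: cont_funM => //; exact: exprn_continuous.
Qed.

(** Subtracting the Taylor polynomial of the cosine in [t * s] leaves the integral unchanged, its
    terms being moments of order below [K]. The remainder costs [|t * s| ^+ K], and the decay of
    order [K.+1] still leaves an integrable factor. *)
Lemma moment_estimate (G : R -> R) (A c s : R) (K : nat) : continuous G ->
  (forall t, `|G t| <= A / oneDsqr t ^+ K.+1) ->
  (forall q, (q < K)%N -> \int[mu]_t (t ^+ q * G t) = 0) ->
  `|\int[mu]_t (G t * cos (c + t * s))| <= A * `|s| ^+ K * oneDsqrV_int.
Proof.
move=> cG hG hm.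
have bq (t : R) q : (q <= K)%N -> `|t ^+ q * G t| <= A / oneDsqr t.
  by move=> qK; exact: (pow_decay qK (hG t)).
have dq q : (q <= K)%N -> decay1 (fun t => t ^+ q * G t).
  by move=> qK; exact: decay1_pow hG.
pose p := cos_poly K c.
pose P t := \sum_(q < K) (p`_q * s ^+ q) * (t ^+ q * G t).
have PE t : G t * p.[t * s] = P t.
  rewrite (@horner_coef_wide _ K) ?size_poly // mulr_sumr.
  by apply: eq_bigr => q _; rewrite exprMn; ring.
have dP : decay1 P.
  by apply: decay1_sum => q; apply: decay1Z; apply: dq; exact: ltnW.
have P0 : \int[mu]_t P t = 0.
  apply: int1_sum0 => q; first by apply: decay1Z; apply: dq; exact: ltnW.
  by rewrite int1Z ?hm ?mulr0 //; apply: dq; exact: ltnW.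
have dG : decay1 G.
  by have := dq 0%N isT; under eq_fun do rewrite expr0 mul1r.
have dC : decay1 (fun t => G t * cos (c + t * s)).
  apply: (@decay1M _ _ _ 1 dG); first exact: continuous_cos_affine.
  by move=> t; exact: cos_bound.
have dN : decay1 (fun t => -1 * P t) by exact: decay1Z.
have -> : \int[mu]_t (G t * cos (c + t * s)) =
    \int[mu]_t (G t * cos (c + t * s) + -1 * P t).
  by rewrite int1D // int1Z // P0 mulr0 addr0.
apply: le_int1.
  by apply: continuous_measurable_fun; exact: (decay1D dC dN).1.
move=> t; rewrite -PE mulN1r -mulrBr normrM.
apply: (le_trans (ler_wpM2l (normr_ge0 _) (cos_taylor _ _ _))).
rewrite normrM exprMn mulrCA mulrA -normrX -normrM mulrAC.
by rewrite ler_wpM2r ?exprn_ge0 // bq.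
Qed.

(** Peetre's inequality in each coordinate of [l] loses one factor [oneDsqr (x 0 i)]; this accounts
    for the exponent [K.+1 + size l] in [FT_estimate]. *)
Lemma weightV_shear l i (xi : V) (B : R) x : xi 0 i = 1 -> i \notin l ->
  (forall j, `|xi 0 j| <= B) ->
  (weight l (shear i xi x))^-1 <=
  (2 * oneDsqr B * oneDsqr (x 0 i)) ^+ size l / weight l x.
Proof.
move=> xi1 + hB; elim: l => [|j l IH] /=.
  by rewrite /weight !big_nil expr0 mul1r.
rewrite inE negb_or => /andP[ij /IH{}IH].
rewrite !weight_cons exprS !invfM mulrACA ler_pM ?invr_ge0 ?(ltW (weight_gt0 _ _)) //.
rewrite shearE // eq_sym (negbTE ij); apply: (le_trans (oneDsqrV_shift _ _)).
rewrite ler_wpM2r // -mulrA ler_wpM2l //.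
have : xi 0 j ^+ 2 <= B ^+ 2.
  rewrite -(real_normK (num_real (xi 0 j))) lerXn2r ?nnegrE //.
  exact: le_trans (normr_ge0 _) (hB j).
rewrite /oneDsqr exprMn.
by have := sqr_ge0 (x 0 i); have := sqr_ge0 B; nra.
Qed.

(* The bound is uniform in [xi], which is what lets [xi] approach the hyperplane
   orthogonal to [y]. *)
Lemma FT_estimate l i (K : nat) (xi y : V) (F : V -> R) (M B b : R) x :
  xi 0 i = 1 -> uniq (i :: l) -> (forall j, j != i -> j \in l) ->
  continuous F ->
  (forall z, `|F z| <= M / (oneDsqr (z 0 i) ^+ (K.+1 + size l) * weight l z)) ->
  (forall j, `|xi 0 j| <= B) ->
  (forall (z : V) q, z 0 i = 0 -> (q < K)%N ->
    \int[mu]_t (t ^+ q * F (z + t *: xi)) = 0) ->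
  `|pints (i :: l) (fun z => F z * phase y b z) x| <=
  M * (2 * oneDsqr B) ^+ size l * oneDsqrV_int ^+ (size l).+1 * `|dotp xi y| ^+ K.
Proof.
move=> xi1 u al cF hF hB hm.
have /andP[il ul] := u.
have M0 : 0 <= M.
  have := le_trans (normr_ge0 _) (hF 0).
  by rewrite pmulr_lge0 // invr_gt0 mulr_gt0 ?exprn_gt0 ?oneDsqr_gt0 ?weight_gt0.
pose N := M * (2 * oneDsqr B) ^+ size l.
have N0 : 0 <= N by rewrite mulr_ge0 // exprn_ge0.
(* The [size l] extra powers pay for the shear; [K.+1] remain for [moment_estimate]. *)
have hS z : `|F (shear i xi z)| <= N / (oneDsqr (z 0 i) ^+ K.+1 * weight l z).
  apply: (le_trans (hF _)); rewrite shearE // eqxx.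
  have o0 := lt0r_neq0 (oneDsqr_gt0 (z 0 i)).
  have w0 := lt0r_neq0 (weight_gt0 l z).
  rewrite invfM mulrA.
  apply: (le_trans (ler_wpM2l _ (weightV_shear z xi1 il hB))).
    by rewrite mulr_ge0 // invr_ge0 exprn_ge0.
  rewrite le_eqVlt; apply/orP; left; apply/eqP.
  rewrite exprMn exprD /N; field.
  by rewrite w0 !expf_neq0.
have pow (z : V) q r : (q <= r)%N ->
    (oneDsqr (z 0 i) ^+ r * weight l z)^-1 <= (oneDsqr (z 0 i) ^+ q * weight l z)^-1.
  move=> qr; rewrite lef_pV2 ?posrE ?mulr_gt0 ?exprn_gt0 ?oneDsqr_gt0 ?weight_gt0 //.
  by rewrite ler_wpM2r ?(ltW (weight_gt0 _ _)) // ler_weXn2l.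
have dF : decay (i :: l) F.
  split=> //; exists M => z; apply: (le_trans (hF z)).
  rewrite ler_wpM2l // (le_trans (pow z 1%N _ _)) ?expr1 ?weight_cons //.
have cFS : continuous (fun z => F (shear i xi z)).
  by apply: cont_comp; [exact: continuous_shear | exact: cF].
have dFS : decay (i :: l) (fun z => F (shear i xi z)).
  split=> //; exists N => z; apply: (le_trans (hS z)).
  rewrite ler_wpM2l // (le_trans (pow z 1%N _ _)) ?expr1 ?weight_cons //.
have dg := decay_phase y b dF.
have dgS : decay (i :: l) (fun z => F (shear i xi z) * phase y b (shear i xi z)).
  apply: (@decayM _ _ _ 1 dFS); last by move=> z; exact: cos_bound.
  by apply: cont_comp; [exact: continuous_shear | exact: continuous_phase].
rewrite (pints_shear_all x xi1 u al dg dgS).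
have -> : M * (2 * oneDsqr B) ^+ size l * oneDsqrV_int ^+ (size l).+1 * `|dotp xi y| ^+ K
   = (N * `|dotp xi y| ^+ K * oneDsqrV_int) * oneDsqrV_int ^+ size l / weight [::] x.
  by rewrite /weight big_nil invr1 mulr1 exprS /N; ring.
apply: le_pints; rewrite ?cats0 //; first by have [] := decay_pint il dgS.
move=> z; rewrite /pint.
(* On the line through [z0] the phase is affine in [t] with slope [dotp xi y], the small parameter
   of [moment_estimate]. *)
pose z0 := set_coord z i 0.
pose G t := F (z0 + t *: xi).
rewrite (_ : (fun t => _) = (fun t => G t * cos (dotp z0 y + b + t * dotp xi y))); last first.
  apply/funext => t; rewrite shear_line // /phase dotpD dotpZ /G; congr (_ * cos _); ring.
rewrite [leRHS]mulrAC [N * _ / _]mulrAC.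
apply: moment_estimate.
- apply: cont_comp; last exact: cF.
  apply: cont_funD; first exact: cst_continuous.
  by apply: cont_funZ; [move=> t; exact: cvg_id | exact: cst_continuous].
- move=> t; rewrite /G -shear_line //; apply: (le_trans (hS _)).
  by rewrite set_coordE eqxx weight_set_coord // invfM mulrA mulrAC.
- by move=> q qK; apply: hm => //; rewrite set_coordE eqxx.
Qed.

End Iterated.

(** * Polynomials and symmetric tensors *)

Section PolyFacts.
Context {R : realType}.
Implicit Types p q : {poly R}.

Lemma poly_eq0 p : (forall x, p.[x] = 0) -> p = 0.
Proof.
move=> p0; apply/eqP; apply: contraT => pn0.
pose rs : seq R := [seq i%:R | i <- iota 0 (size p)].
have ar : all (root p) rs by apply/allP => x _; apply/rootP.
have ur : uniq rs.
  rewrite map_inj_uniq ?iota_uniq // => a b /eqP.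
  by rewrite eqr_nat => /eqP.
by have := max_poly_roots pn0 ar ur; rewrite size_map size_iota ltnn.
Qed.

Lemma poly_eq0_cofinite p (a : R) : (forall x, x != a -> p.[x] = 0) -> p = 0.
Proof.
move=> p0; have /eqP : p * ('X - a%:P) = 0.
  apply: poly_eq0 => x; rewrite hornerM hornerXsubC.
  by have [->|xa] := eqVneq x a; rewrite ?subrr ?mulr0 // p0 ?mul0r.
by rewrite mulf_eq0 polyXsubC_eq0 orbF => /eqP.
Qed.

(** Induction on [k]: the bound near 0 kills the constant coefficient, and division by the variable
    lowers both the degree bound and the order by one. *)
Lemma poly_small_eq0 (k : nat) p (C e : R) : 0 < e -> (size p <= k)%N ->
  (forall s, 0 < `|s| < e -> `|p.[s]| <= C * `|s| ^+ k) -> p = 0.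
Proof.
elim: k p => [|k IH] p e0 sp hp.
  by apply/eqP; rewrite -size_poly_eq0 -leqn0.
pose q := drop_poly 1 p; pose a := p`_0.
have pE s : p.[s] = a + q.[s] * s.
  rewrite -[in LHS](poly_take_drop 1 p) hornerD hornerM hornerXn expr1.
  congr (_ + _); rewrite -(hornerC a s); congr (_.[s]); apply/polyP => i.
  by rewrite coef_take_poly coefC; case: i.
pose Q := \sum_(i < size q) `|q`_i|.
have qQ s : `|s| <= 1 -> `|q.[s]| <= Q.
  move=> s1; rewrite horner_coef; apply: (le_trans (ler_norm_sum _ _ _)).
  apply: ler_sum => i _; rewrite normrM normrX ler_piMr //.
  by rewrite exprn_ile1.
have Q0 : 0 <= Q by apply: sumr_ge0.
have a0 : a = 0.
  apply/eqP; apply: contraT => an0.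
  have na : 0 < `|a| by rewrite normr_gt0.
  pose T := `|C| + Q + 1.
  have T0 : 0 < T by rewrite /T; have := normr_ge0 C; lra.
  (* For this [s] the constant coefficient would satisfy
     [|a| <= (|C| + Q) * s < T * s <= |a| / 2]. *)
  pose s := Num.min (Num.min (e / 2) 1) (`|a| / (2 * T)).
  have s0 : 0 < s by rewrite !lt_min ltr01 !divr_gt0 ?mulr_gt0.
  have se : s < e.
    apply: (@le_lt_trans _ _ (e / 2)); last by lra.
    by rewrite /s !ge_min lexx.
  have s1 : s <= 1 by rewrite /s !ge_min lexx orbT.
  have sa : s * (2 * T) <= `|a|.
    by rewrite -ler_pdivlMr ?mulr_gt0 // /s ge_min lexx orbT.
  have := hp s; rewrite gtr0_norm // s0 se => /(_ isT) ps.
  have h1 : `|p.[s]| <= `|C| * s.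
    apply: (le_trans ps); apply: (@le_trans _ _ (`|C| * s ^+ k.+1)).
      by rewrite ler_wpM2r ?ler_norm // exprn_ge0 // ltW.
    rewrite ler_wpM2l // exprS ler_piMr ?(ltW s0) //.
    by rewrite exprn_ile1 // ltW.
  have h2 : `|q.[s] * s| <= Q * s.
    rewrite normrM (gtr0_norm s0) ler_wpM2r ?(ltW s0) // qQ //.
    by rewrite gtr0_norm.
  have h3 : `|a| <= `|p.[s]| + `|q.[s] * s|.
    by rewrite (_ : a = p.[s] - q.[s] * s) ?ler_normB // pE addrK.
  by exfalso; rewrite /T in sa; nra.
have q0 : q = 0.
  apply: (IH q) => //; first by rewrite size_drop_poly leq_subLR add1n.
  move=> s /andP[s0 se]; have := hp s; rewrite s0 se => /(_ isT).
  by rewrite pE a0 add0r normrM exprSr mulrA ler_pM2r.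
apply: poly_eq0 => s; by rewrite pE a0 q0 horner0 mul0r addr0.
Qed.

Lemma size_deriv_le k p : (size p^`() <= k)%N -> (size p <= k.+1)%N.
Proof.
move=> /leq_sizeP h; apply/leq_sizeP => -[//|j] kj.
have /eqP := h j kj; rewrite coef_deriv -mulr_natr mulf_eq0 pnatr_eq0 orbF.
by move/eqP.
Qed.

End PolyFacts.

Section Tensor.
Context {R : realType} {n : nat}.
Notation V := 'rV[R]_n.
Notation T := (seq 'I_n -> R).
Implicit Types (c : T) (xi eta y : V).

(* Tensors of order [m] are stored as the values of [c] on sequences of length
   [m]; the other values of [c] are irrelevant. *)
Fixpoint contr m c xi : R :=
  if m is m'.+1 then \sum_i xi 0 i * contr m' (fun s => c (i :: s)) xi
  else c [::].

(** On the Fourier side this is the divergence, up to a shift of phase ([FT_rdiv]). *)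
Definition lin eta c : T := fun s => \sum_j eta 0 j * c (j :: s).

Definition symmetric_coef c := forall s t : seq 'I_n, perm_eq s t -> c s = c t.

(** The restriction of [contr m c] to the line [xi + s eta] as a formal polynomial in [s], so that
    degree and derivative make sense. *)
Fixpoint pcontr m c xi eta : {poly R} :=
  if m is m'.+1 then
    \sum_i ((xi 0 i)%:P + eta 0 i *: 'X) * pcontr m' (fun s => c (i :: s)) xi eta
  else (c [::])%:P.

Lemma contr_ext m c c' xi : (forall s, size s = m -> c s = c' s) ->
  contr m c xi = contr m c' xi.
Proof.
elim: m c c' => [|m IH] c c' E /=; first exact: E.
by apply: eq_bigr => i _; congr (_ * _); apply: IH => s hs; apply: E => /=; rewrite hs.
Qed.

Lemma pcontr_ext m c c' xi eta : (forall s, size s = m -> c s = c' s) ->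
  pcontr m c xi eta = pcontr m c' xi eta.
Proof.
elim: m c c' => [|m IH] c c' E /=; first by rewrite E.
by apply: eq_bigr => i _; congr (_ * _); apply: IH => s hs; apply: E => /=; rewrite hs.
Qed.

Lemma horner_pcontr m c xi eta (s : R) :
  (pcontr m c xi eta).[s] = contr m c (xi + s *: eta).
Proof.
elim: m c => [|m IH] c /=; first by rewrite hornerC.
rewrite horner_sum; apply: eq_bigr => i _.
by rewrite hornerM IH hornerD hornerC hornerZ hornerX !mxE (mulrC s).
Qed.

Lemma contrZ m c (a : R) xi : contr m c (a *: xi) = a ^+ m * contr m c xi.
Proof.
elim: m c => [|m IH] c /=; first by rewrite expr0 mul1r.
by rewrite mulr_sumr; apply: eq_bigr => i _; rewrite IH mxE exprS; ring.
Qed.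

Lemma pcontr_lin m c xi eta eta' :
  pcontr m (lin eta' c) xi eta =
  \sum_j eta' 0 j *: pcontr m (fun s => c (j :: s)) xi eta.
Proof.
suff H (d : 'I_n -> T) (a : 'I_n -> R) :
    pcontr m (fun s => \sum_j a j * d j s) xi eta =
    \sum_j a j *: pcontr m (d j) xi eta by exact: H.
elim: m d => [|m IH] d /=.
  by rewrite rmorph_sum /=; apply: eq_bigr => j _; rewrite polyCM mul_polyC.
under eq_bigr do rewrite IH mulr_sumr.
rewrite exchange_big; apply: eq_bigr => j _; rewrite scaler_sumr.
by apply: eq_bigr => i _; rewrite scalerAr.
Qed.

Lemma symmetric_coef_cons c i : symmetric_coef c -> symmetric_coef (fun s => c (i :: s)).
Proof. by move=> sc s t st; apply: sc; rewrite perm_cons. Qed.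

Lemma symmetric_coef_lin c eta : symmetric_coef c -> symmetric_coef (lin eta c).
Proof.
move=> sc s t st; apply: eq_bigr => j _; congr (_ * _).
by apply: sc; rewrite perm_cons.
Qed.

Lemma pcontrS m c xi eta : pcontr m.+1 c xi eta =
  \sum_i ((xi 0 i)%:P + eta 0 i *: 'X) * pcontr m (fun s => c (i :: s)) xi eta.
Proof. by []. Qed.

(** By the product rule each slot contributes a contraction with [eta], and symmetry makes the
    [m.+1] contributions equal. *)
Lemma deriv_pcontr m c xi eta : symmetric_coef c ->
  (pcontr m.+1 c xi eta)^`() = pcontr m (lin eta c) xi eta *+ m.+1.
Proof.
elim: m c => [|m IH] c sc.
  rewrite pcontr_lin raddf_sum /= mulr1n; apply: eq_bigr => i _.
  by rewrite derivM derivD !derivC derivZ derivX add0r mulr0 addr0 -mul_polyC mulr1 mul_polyC.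
rewrite pcontrS raddf_sum [RHS]mulrS {1}pcontr_lin pcontrS.
rewrite -mulr_natr mulr_suml -big_split; apply: eq_bigr => i _.
rewrite -[LHS]/(deriv _).
rewrite derivM derivD derivC derivZ derivX add0r.
have -> := IH (fun s => c (i :: s)) (symmetric_coef_cons i sc).
rewrite alg_polyC mul_polyC; congr (_ + _).
rewrite -[_ *+ m.+1]mulr_natr mulrA; congr (_ * _ * _).
apply: pcontr_ext => s _; apply: eq_bigr => j _; congr (_ * _).
by apply: sc; rewrite (perm_catCA [:: i] [:: j] s).
Qed.

(** Each derivative contracts once more with [eta], so the k-th derivative vanishes, which in
    characteristic 0 bounds the degree. *)
Lemma size_pcontr k m c xi eta : symmetric_coef c -> (k <= m)%N ->
  (forall s, size s = (m - k)%N -> iter k (lin eta) c s = 0) ->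
  (size (pcontr m c xi eta) <= k)%N.
Proof.
elim: k m c => [|k IH] m c sc km hc.
  rewrite leqn0 size_poly_eq0 (@pcontr_ext _ _ (fun=> 0)).
    elim: m {km hc} => [|m IH'] /=; first by rewrite polyC0.
    by under eq_bigr do rewrite (eqP IH') mulr0; rewrite big1.
  by move=> s hs; apply: hc; rewrite subn0.
case: m km hc => // m km hc; apply: size_deriv_le.
rewrite deriv_pcontr // -scaler_nat (leq_trans (size_scale_leq _ _)) //.
apply: IH => //; first exact: symmetric_coef_lin.
by move=> s hs; rewrite -iterSr; apply: hc.
Qed.

(** Differentiating the zero form in the direction of the i-th basis vector shows that the form with
    first index [i] fixed vanishes too; then induct on the order. *)
Lemma polarization m c : symmetric_coef c -> (forall xi, contr m c xi = 0) ->
  forall s, size s = m -> c s = 0.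
Proof.
elim: m c => [|m IH] c sc hc s; first by move/size0nil => ->; exact: (hc 0).
case: s => // i s [hs].
apply: (IH (fun s => c (i :: s))) => //; first exact: symmetric_coef_cons.
move=> xi.
have P0 : pcontr m.+1 c xi (delta_mx 0 i) = 0.
  by apply: poly_eq0 => x; rewrite horner_pcontr hc.
have /eqP := deriv_pcontr m xi (delta_mx 0 i) sc.
rewrite P0 deriv0 eq_sym -scaler_nat scaler_eq0 pnatr_eq0 => /eqP E.
have := horner_pcontr m (lin (delta_mx 0 i) c) xi (delta_mx 0 i) 0.
rewrite E horner0 scale0r addr0 => E'; rewrite E'; apply: contr_ext => t _.
rewrite /lin (bigD1 i) //= big1; last first.
  by move=> j ji; rewrite mxE (negbTE ji) andbF mul0r.
by rewrite mxE !eqxx mul1r addr0.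
Qed.

(** The estimate covers only vectors with [o]-coordinate 1. For [xi0] orthogonal to [y], the line
    [xi0 + s y] is treated first when [xi0 0 o = 1], then by homogeneity when [xi0 0 o != 0], and
    finally in general by perturbing [xi0] inside the hyperplane. *)
Lemma tensor_vanish (m K : nat) c y (o o' : 'I_n) : o != o' ->
  (forall i, y 0 i != 0) -> symmetric_coef c -> (K <= m)%N ->
  (forall s, size s = (m - K)%N -> iter K (lin y) c s = 0) ->
  (forall B : R, exists C : R, forall xi, xi 0 o = 1 ->
    (forall j, `|xi 0 j| <= B) -> `|contr m c xi| <= C * `|dotp xi y| ^+ K) ->
  forall s, size s = m -> c s = 0.
Proof.
move=> oo' hy sc Km hdiv hest.
pose N := dotp y y.
have N0 : 0 < N.
  rewrite /N /dotp (bigD1 o) //= ltr_wpDr ?sumr_ge0 //.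
    by move=> i _; rewrite -expr2 sqr_ge0.
  by rewrite -expr2 exprn_even_gt0 //= hy.
(* The estimate needs [xi 0 o = 1], whence the rescaling by [a] below. *)
have stepA xi0 : dotp xi0 y = 0 -> xi0 0 o = 1 ->
    forall s, contr m c (xi0 + s *: y) = 0.
  move=> xy xo s; rewrite -horner_pcontr.
  suff -> : pcontr m c xi0 y = 0 by rewrite horner0.
  (* For [|s| < e] both [|s| <= 1] and [|s * y 0 o| <= 1/2] hold, so the factor [a] below stays in
     [[1/2, 2]] and [xi] stays in the box of size [B]. *)
  pose e : R := (2 * (`|y 0 o| + 1))^-1.
  have yo0 := normr_ge0 (y 0 o).
  have e0 : 0 < e by rewrite invr_gt0; lra.
  pose B := 2 * \sum_j (`|xi0 0 j| + `|y 0 j|).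
  have [C hC] := hest B.
  (* [2 ^+ m] bounds [a ^+ m], and [2 * N] comes from [dotp xi y = a^-1 * s * N]. *)
  apply: (@poly_small_eq0 _ K _ (2 ^+ m * `|C| * (2 * N) ^+ K) e e0).
    exact: size_pcontr.
  move=> {}s /andP[s0 se]; rewrite horner_pcontr.
  have sy : `|s * y 0 o| <= 2^-1.
    rewrite normrM; have : `|s| * (2 * (`|y 0 o| + 1)) <= 1.
      by rewrite -ler_pdivlMr ?mul1r ?ltW //; lra.
    by have := normr_ge0 s; nra.
  have s1 : `|s| <= 1.
    apply: (le_trans (ltW se)); rewrite /e invf_le1; lra.
  pose a := 1 + s * y 0 o.
  have [a1 a2] : 2^-1 <= a /\ a <= 2.
    by move: sy; rewrite ler_norml /a => /andP[]; lra.
  have a0 : 0 < a by lra.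
  have an0 : a != 0 by rewrite lt0r_neq0.
  pose xi := a^-1 *: (xi0 + s *: y).
  have aV : 0 <= a^-1 <= 2.
    rewrite invr_ge0 ltW //=; have -> : (2 : R) = (2^-1)^-1 by rewrite invrK.
    by rewrite lef_pV2 ?posrE //; lra.
  have xio : xi 0 o = 1 by rewrite /xi !mxE xo mulVf.
  have xiB j : `|xi 0 j| <= B.
    have [aV0 aV2] := andP aV.
    rewrite /xi !mxE normrM (ger0_norm aV0) /B.
    rewrite ler_pM //; apply: (le_trans (ler_normD _ _)).
    rewrite (bigD1 j) //= -[leLHS]addr0 lerD //; last first.
      by apply: sumr_ge0 => i _; rewrite addr_ge0.
    by rewrite lerD2l normrM ler_piMl.
  have -> : xi0 + s *: y = a *: xi by rewrite /xi scalerA mulfV // scale1r.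
  rewrite contrZ normrM -!mulrA ler_pM //.
    by rewrite normrX lerXn2r ?nnegrE // ger0_norm // ltW.
  apply: (le_trans (hC xi xio xiB)).
  apply: (@le_trans _ _ (`|C| * `|dotp xi y| ^+ K)).
    by rewrite ler_wpM2r ?ler_norm // exprn_ge0.
  rewrite ler_wpM2l // -exprMn lerXn2r ?nnegrE ?mulr_ge0 ?(ltW N0) //.
  rewrite /xi dotpZ dotpD dotpZ xy add0r !normrM (gtr0_norm N0).
  have [aV0 aV2] := andP aV; rewrite (ger0_norm aV0).
  by rewrite mulrCA mulrC ler_wpM2r // ler_wpM2r ?(ltW N0).
have stepB xi0 : dotp xi0 y = 0 -> xi0 0 o != 0 ->
    forall s, contr m c (xi0 + s *: y) = 0.
  move=> xy xo s; set a := xi0 0 o in xo *.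
  have -> : xi0 + s *: y = a *: (a^-1 *: xi0 + (a^-1 * s) *: y).
    by rewrite -scalerA -scalerDr scalerA mulfV // scale1r.
  rewrite contrZ stepA ?mulr0 //; first by rewrite dotpZ xy mulr0.
  by rewrite mxE mulVf.
(* A direction orthogonal to [y] along which the [o]-coordinate varies. *)
pose xis : V := delta_mx 0 o - (y 0 o / y 0 o') *: delta_mx 0 o'.
have xisy : dotp xis y = 0.
  rewrite /xis dotpD -scaleNr dotpZ !dotp_delta mulNr divfK ?subrr //.
have xiso : xis 0 o = 1.
  by rewrite /xis !mxE !eqxx (negbTE oo') andbF mulr0 subr0.
apply: polarization => // xi.
pose s := dotp xi y / N.
pose xi0 := xi - s *: y.
have xi0y : dotp xi0 y = 0.
  by rewrite /xi0 dotpD -scaleNr dotpZ -/N /s mulNr divfK ?subrr // lt0r_neq0.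
(* Along [xis] the [o]-coordinate of the orthogonal part vanishes for a single [t]; everywhere else
   [stepB] applies. *)
have P0 : pcontr m c xi xis = 0.
  apply: (@poly_eq0_cofinite _ _ (- xi0 0 o)) => t ht.
  rewrite horner_pcontr.
  have -> : xi + t *: xis = (xi0 + t *: xis) + s *: y.
    by rewrite /xi0 addrAC subrK.
  apply: stepB; first by rewrite dotpD dotpZ xi0y xisy mulr0 addr0.
  by rewrite mxE [in X in _ + X]mxE xiso mulr1 addrC addr_eq0.
by have := horner_pcontr m c xi xis 0; rewrite P0 horner0 scale0r addr0.
Qed.

End Tensor.

(** * Moments and Schwartz tensor fields *)

Section Moments.
Context {R : realType}.
Notation mu := (@lebesgue_measure R).

Lemma decay1_polyM (G : R -> R) (K : nat) (p : {poly R}) : (size p <= K)%N ->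
  (forall q, (q < K)%N -> decay1 (fun t => t ^+ q * G t)) ->
  decay1 (fun t => p.[t] * G t).
Proof.
move=> sp dq.
rewrite (_ : (fun t => _) = fun t => \sum_(q < K) p`_q * (t ^+ q * G t)).
  by apply: decay1_sum => q; apply: decay1Z; exact: dq.
apply/funext => t; rewrite (horner_coef_wide _ sp) mulr_suml.
by apply: eq_bigr => q _; rewrite mulrA.
Qed.

Lemma size_lin_exp (a b : R) q : (size ((a *: 'X + b%:P : {poly R}) ^+ q) <= q.+1)%N.
Proof.
apply: (leq_trans (size_poly_exp_leq _ _)).
rewrite ltnS -[leqRHS]mul1n leq_mul2r; apply/orP; right.
rewrite -subn1 leq_subLR; apply: (leq_trans (size_polyD _ _)).
rewrite geq_max (leq_trans (size_scale_leq _ _)) ?size_polyX //.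
by rewrite (leq_trans (size_polyC_leq1 _)).
Qed.

Lemma horner_lin_exp (a b t : R) q :
  ((a *: 'X + b%:P : {poly R}) ^+ q).[t] = (a * t + b) ^+ q.
Proof. by rewrite horner_exp hornerD hornerZ hornerX hornerC. Qed.

Lemma decay1_linM (G : R -> R) (K j : nat) (r b : R) : (j < K)%N ->
  (forall q, (q < K)%N -> decay1 (fun t => t ^+ q * G t)) ->
  decay1 (fun t => (r * t + b) ^+ j * G t).
Proof.
move=> jK dq.
rewrite (_ : (fun t => _) = fun t => ((r *: 'X + b%:P) ^+ j).[t] * G t).
  by apply: (@decay1_polyM _ K _ _ dq); apply: leq_trans (size_lin_exp _ _ _) jK.
by apply/funext => t; rewrite horner_lin_exp.
Qed.

(** [t ^+ q] is a polynomial of degree at most [q] in [r * t + b]. *)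
Lemma moment_affine (G : R -> R) (K : nat) (r b : R) : r != 0 ->
  (forall q, (q < K)%N -> decay1 (fun t => t ^+ q * G t)) ->
  (forall q, (q < K)%N -> \int[mu]_t ((r * t + b) ^+ q * G t) = 0) ->
  forall q, (q < K)%N -> \int[mu]_t (t ^+ q * G t) = 0.
Proof.
move=> r0 dq hm q qK.
pose p : {poly R} := (r^-1 *: 'X + (- b / r)%:P) ^+ q.
rewrite (_ : (fun t => _) = fun t =>
    \sum_(j < q.+1) p`_j * ((r * t + b) ^+ j * G t)); last first.
  apply/funext => t.
  have -> : t ^+ q = p.[r * t + b].
    by rewrite /p horner_lin_exp; congr (_ ^+ q); field.
  rewrite (horner_coef_wide _ (size_lin_exp _ _ _)) mulr_suml.
  by apply: eq_bigr => j _; rewrite mulrA.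
have jK (j : 'I_q.+1) : (j < K)%N by apply: leq_trans (ltn_ord j) _.
apply: int1_sum0 => j; first by apply: decay1Z; apply: decay1_linM (jK j) dq.
rewrite int1Z; first by rewrite hm ?mulr0.
exact: decay1_linM (jK j) dq.
Qed.

End Moments.

Section Schwartz.
Context {R : realType} {n : nat}.
Notation V := 'rV[R]_n.
Implicit Types (g h : V -> R) (l s : seq 'I_n).

Lemma schwartz_continuous g : schwartz g -> continuous g.
Proof. by case=> /(_ [::]) []. Qed.

Lemma schwartz_derivable g i (x : V) : schwartz g -> derivable g x (delta_mx 0 i).
Proof. by case=> sg _; have [_ d] := sg [::]; exact: d. Qed.

Lemma schwartz_pderiv g i : schwartz g -> schwartz (pderiv i g).
Proof.
move=> [sg bg].
have E s : pderivs s (pderiv i g) = pderivs (rcons s i) g.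
  by rewrite /pderivs foldr_rcons.
split; first by move=> s; rewrite E; exact: sg.
by move=> a s; rewrite E; exact: bg.
Qed.

Lemma pderivsD s g h : smooth g -> smooth h ->
  pderivs s (fun x => g x + h x) = (fun x => pderivs s g x + pderivs s h x).
Proof.
move=> sg sh; elim: s => [//|i s IH] /=.
apply/funext => x; rewrite IH /pderiv.
rewrite -(@deriveD _ _ _ (pderivs s g) (pderivs s h)) //.
- by have [_] := sg s.
- by have [_] := sh s.
Qed.

Lemma schwartzD g h : schwartz g -> schwartz h -> schwartz (fun x => g x + h x).
Proof.
move=> [sg bg] [sh bh]; split=> [s|a s]; rewrite pderivsD //.
  have [cg dg] := sg s; have [ch dh] := sh s.
  split; first exact: cont_funD.
  by move=> i x; apply: derivableD.
have [M hM] := bg a s; have [N hN] := bh a s; exists (M + N) => x.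
by rewrite mulrDr (le_trans (ler_normD _ _)) // lerD.
Qed.

Lemma pderivs0 s : pderivs s (fun=> 0 : R) = (fun _ : V => 0).
Proof.
elim: s => [//|i s IH] /=; rewrite IH; apply/funext => x.
by rewrite /pderiv derive_cst.
Qed.

Lemma schwartz0 : schwartz (fun _ : V => 0 : R).
Proof.
split=> [s|a s]; rewrite pderivs0.
  by split=> [|i x]; [exact: cst_continuous | exact: derivable_cst].
by exists 0 => x; rewrite mulr0 normr0.
Qed.

Lemma schwartz_sum (I : Type) (r : seq I) (F : I -> V -> R) :
  (forall a, schwartz (F a)) -> schwartz (fun x => \sum_(a <- r) F a x).
Proof.
move=> hF; elim: r => [|a r IH].
  rewrite (_ : (fun x => \sum_(a <- [::]) F a x) = (fun=> 0)).
    exact: schwartz0.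
  by apply/funext => x; rewrite big_nil.
rewrite (_ : (fun x => \sum_(b <- a :: r) F b x) =
    (fun x => F a x + \sum_(b <- r) F b x)); first exact: schwartzD.
by apply/funext => x; rewrite big_cons.
Qed.

(** The induction is generalized over a monomial factor: the square in [oneDsqr (x 0 i)] is absorbed
    by raising its i-th exponent by 2. *)
Lemma schwartz_weight g l : schwartz g ->
  exists M : R, forall x, `|g x| <= M / weight l x.
Proof.
move=> [_ bg].
suff /(_ (fun=> 0%N)) [M hM] : forall a : 'I_n -> nat, exists M : R, forall x : V,
    `|(\prod_(i < n) x 0 i ^+ a i) * g x| * weight l x <= M.
  exists M => x; rewrite ler_pdivlMr ?weight_gt0 //.
  by have := hM x; rewrite big1 ?mul1r.
elim: l => [|i l IH] a.
  by have [M hM] := bg a [::]; exists M => x; rewrite /weight big_nil mulr1; exact: hM.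
have [M hM] := IH a.
have [N hN] := IH (fun j => if j == i then (a j).+2 else a j).
exists (M + N) => x; rewrite weight_cons /oneDsqr mulrDl mul1r mulrDr lerD //.
apply: le_trans (hN x); rewrite mulrA ler_wpM2r ?(ltW (weight_gt0 _ _)) //.
rewrite -[x 0 i ^+ 2]ger0_norm ?sqr_ge0 // -normrM.
rewrite le_eqVlt; apply/orP; left; apply/eqP; congr `|_|.
rewrite mulrAC; congr (_ * _).
rewrite (bigD1 i) //= [in RHS](bigD1 i) //= eqxx mulrAC -exprD addn2.
by congr (_ * _); apply: eq_bigr => j /negbTE ->.
Qed.

Lemma schwartz_decay g l : schwartz g -> decay l g.
Proof.
by move=> sg; split; [exact: schwartz_continuous | exact: schwartz_weight].
Qed.

End Schwartz.

(** * The theorem for real-valued fields *)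

Section RealCase.
Context {R : realType} {n : nat}.
Notation mu := (@lebesgue_measure R).
Notation V := 'rV[R]_n.
Implicit Types (U : seq 'I_n -> V -> R) (l s : seq 'I_n).

(** The new index goes last to match [divergence]. Indexing by sequences of every length keeps the
    iterates in one type. *)
Definition rdiv U s (x : V) : R := \sum_j pderiv j (U (rcons s j)) x.

Definition FT l U y b (x : V) s : R := pints l (fun z => U s z * phase y b z) x.

Definition symmetric_field U := forall s t : seq 'I_n, perm_eq s t -> U s = U t.

Lemma symmetric_field_rdiv U : symmetric_field U -> symmetric_field (rdiv U).
Proof.
move=> sU s t st; apply/funext => x; apply: eq_bigr => j _.
by rewrite (sU (rcons s j) (rcons t j)) // -!cats1 perm_cat2r.
Qed.

Lemma schwartz_rdiv U : (forall s, schwartz (U s)) -> forall s, schwartz (rdiv U s).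
Proof. by move=> hU s; apply: schwartz_sum => j; exact: schwartz_pderiv. Qed.

Lemma FT_rdiv l U y b x s : uniq l -> (forall j, j \in l) ->
  (forall s, schwartz (U s)) -> symmetric_field U ->
  FT l (rdiv U) y b x s = lin y (FT l U y (b - pi / 2) x) s.
Proof.
move=> u al hU sU; rewrite /FT /rdiv.
rewrite (@pints_ext _ _ _ _ (fun z => \sum_j pderiv j (U (rcons s j)) z * phase y b z)).
  rewrite pints_sum //; last first.
    by move=> j; apply: decay_phase; apply: schwartz_decay; exact: schwartz_pderiv.
  apply: eq_bigr => j _; rewrite FT_pderiv //.
  - by rewrite (sU (rcons s j) (j :: s)) // perm_rcons.
  - by move=> z; exact: schwartz_derivable.
  - exact: schwartz_decay.
  - by apply: schwartz_decay; exact: schwartz_pderiv.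
by move=> z; rewrite mulr_suml.
Qed.

Lemma FT_iter_rdiv l U p y b x : uniq l -> (forall j, j \in l) ->
  (forall s, schwartz (U s)) -> symmetric_field U ->
  FT l (iter p rdiv U) y b x =
  iter p (lin y) (FT l U y (b - p%:R * (pi / 2)) x).
Proof.
move=> u al hU sU; elim: p b => [|p IH] b; first by rewrite mul0r subr0.
have [hp sp] : (forall s, schwartz (iter p rdiv U s)) /\ symmetric_field (iter p rdiv U).
  elim: p {IH} => [|p [IH1 IH2]] //=.
  by split; [exact: schwartz_rdiv | exact: symmetric_field_rdiv].
apply/funext => s; rewrite [in LHS]iterS FT_rdiv // IH iterS.
by congr (lin y (iter p (lin y) (FT l U y _ x)) s); rewrite -natr1; ring.
Qed.

Lemma decay_contr l m U (xi : V) : (forall s, decay l (U s)) ->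
  decay l (fun z => contr m (U^~ z) xi).
Proof.
elim: m U => [|m IH] U hU /=; first exact: hU.
apply: decay_sum => i; apply: decayZ.
exact: (IH (fun s => U (i :: s))).
Qed.

Lemma FT_contr l m U (xi y : V) b x : uniq l -> (forall s, decay l (U s)) ->
  pints l (fun z => contr m (U^~ z) xi * phase y b z) x = contr m (FT l U y b x) xi.
Proof.
move=> u; elim: m U => [//|m IH] U hU /=.
rewrite (@pints_ext _ _ _ _ (fun z => \sum_i xi 0 i *
    (contr m (fun s => U (i :: s) z) xi * phase y b z))); last first.
  by move=> z; rewrite mulr_suml; apply: eq_bigr => i _; rewrite mulrA.
have d i : decay l (fun z => contr m (fun s => U (i :: s) z) xi * phase y b z).
  by apply: decay_phase; apply: (@decay_contr l m (fun s => U (i :: s))).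
rewrite pints_sum //; last by move=> i; exact: decayZ.
by apply: eq_bigr => i _; rewrite pintsZ // (IH (fun s => U (i :: s))).
Qed.

Lemma contr_bound m (c : seq 'I_n -> R) (xi : V) (A B : R) :
  (forall j, `|xi 0 j| <= B) -> (forall s, size s = m -> `|c s| <= A) ->
  `|contr m c xi| <= (n%:R * B) ^+ m * A.
Proof.
move=> hB; elim: m c => [|m IH] c hA /=; first by rewrite expr0 mul1r hA.
apply: (le_trans (ler_norm_sum _ _ _)).
have H i : `|xi 0 i * contr m (fun s => c (i :: s)) xi| <= B * ((n%:R * B) ^+ m * A).
  by rewrite normrM ler_pM // IH // => s hs; apply: hA; rewrite /= hs.
apply: (le_trans (ler_sum _ (fun i _ => H i))).
by rewrite sumr_const card_ord -[X in X <= _]mulr_natl exprS !mulrA.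
Qed.

Lemma finite_bound (m : nat) (W : V -> R) U :
  (forall s, exists M : R, forall x, `|U s x| <= M / W x) -> (forall x, 0 < W x) ->
  exists M : R, forall s, size s = m -> forall x, `|U s x| <= M / W x.
Proof.
move=> hU W0; have [M hM] := choice hU.
exists (\sum_(I : m.-tuple 'I_n) `|M I|) => s hs x.
apply: (le_trans (hM s x)); rewrite ler_wpM2r ?invr_ge0 ?(ltW (W0 x)) //.
have e : size s == m by apply/eqP.
rewrite (bigD1 (Tuple e)) //=; apply: (le_trans (ler_norm _)).
by rewrite -[leLHS]addr0 lerD2l sumr_ge0.
Qed.

(** Vanishing moments are given for unit directions and base points orthogonal to them. With [eta]
    the normalized [xi], any line directed by [xi] is such a line with parameter [r * t + b];
    homogeneity contributes a factor [r ^- m], and [moment_affine] returns to powers of [t]. *)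
Lemma moment_reparam m K U (F : V -> V -> R) (xi z : V) (o : 'I_n) (A : R) :
  (forall s, schwartz (U s)) ->
  (F = fun eta z => contr m (U^~ z) eta) ->
  xi 0 o = 1 ->
  (forall t, `|F xi (z + t *: xi)| <= A / oneDsqr t ^+ K.+1) ->
  (forall (x eta : V) q, enorm eta = 1 -> dotp x eta = 0 -> (q < K)%N ->
    \int[mu]_t (t ^+ q * F eta (x + t *: eta)) = 0) ->
  forall q, (q < K)%N -> \int[mu]_t (t ^+ q * F xi (z + t *: xi)) = 0.
Proof.
move=> hU FE xio hA hm.
pose r := enorm xi.
have r2 : 0 < dotp xi xi.
  rewrite /dotp (bigD1 o) //= xio mulr1 ltr_pwDl // sumr_ge0 // => i _.
  by rewrite -expr2 sqr_ge0.
have r0 : 0 < r by rewrite /r /enorm sqrtr_gt0.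
have rr : r ^+ 2 = dotp xi xi by rewrite /r /enorm sqr_sqrtr // ltW.
have rn0 : r != 0 by rewrite lt0r_neq0.
pose eta := r^-1 *: xi.
pose b := dotp z eta.
pose x := z - b *: eta.
have ee : dotp eta eta = 1.
  by rewrite /eta dotpZ dotpC dotpZ -rr; field.
have e1 : enorm eta = 1 by rewrite /enorm ee sqrtr1.
have xe : dotp x eta = 0 by rewrite /x dotpD -scaleNr dotpZ ee mulr1 subrr.
pose G t := F xi (z + t *: xi).
have cG : continuous G.
  rewrite /G FE; apply: (@cont_comp _ _ _ (fun t : R => z + t *: xi) (fun z => contr m (U^~ z) xi)).
    apply: cont_funD; first exact: cst_continuous.
    by apply: cont_funZ; [move=> t; exact: cvg_id | exact: cst_continuous].
  by have [] := @decay_contr [::] m U xi (fun s => schwartz_decay [::] (hU s)).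
have dG q : (q < K)%N -> decay1 (fun t => t ^+ q * G t).
  by move=> qK; exact: (decay1_pow cG (ltnW qK) hA).
apply: (@moment_affine _ G K r b rn0 dG) => q qK.
have zE t : x + (r * t + b) *: eta = z + t *: xi.
  rewrite /x scalerDl addrA addrAC subrK /eta scalerA; congr (_ + _ *: _).
  by field.
have Fr t : F eta (z + t *: xi) = r ^- m * G t.
  by rewrite /G FE /eta contrZ exprVn.
pose H t := t ^+ q * F eta (x + t *: eta).
have HE t : H (r * t + b) = r ^- m * ((r * t + b) ^+ q * G t).
  by rewrite /H zE Fr mulrCA.
have dQ : decay1 (fun t => r ^- m * ((r * t + b) ^+ q * G t)).
  by apply: decay1Z; exact: decay1_linM qK dG.
have dH : decay1 H.
  have := decay1_affine (- b / r) dQ (invr_neq0 rn0).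
  rewrite (_ : (fun t => _) = H) //; apply/funext => t.
  by rewrite -HE; congr H; field.
have := hm x eta q e1 xe qK; rewrite -/H (int1_affine b dH r0) (funext HE).
rewrite int1Z; last exact: decay1_linM qK dG.
move=> /eqP; rewrite !mulf_eq0 (negbTE rn0) invr_eq0 expf_eq0 (negbTE rn0) andbF /=.
by move/eqP.
Qed.

Lemma weight_nseq_cat N (o : 'I_n) l (z : V) :
  weight (nseq N o ++ l) z = oneDsqr (z 0 o) ^+ N * weight l z.
Proof.
elim: N => [|N IH]; first by rewrite expr0 mul1r.
by rewrite weight_cons IH exprS mulrA.
Qed.

Theorem real_vanish (m k : nat) U : (2 <= n)%N -> (k < m)%N ->
  (forall s, schwartz (U s)) -> symmetric_field U ->
  (forall s, size s = (m - k.+1)%N -> forall x, iter k.+1 rdiv U s x = 0) ->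
  (forall (x eta : V) q, enorm eta = 1 -> dotp x eta = 0 -> (q < k.+1)%N ->
    \int[mu]_t (t ^+ q * contr m (U^~ (x + t *: eta)) eta) = 0) ->
  forall s, size s = m -> forall x, U s x = 0.
Proof.
move=> n2 km hU sU hdiv hm s hs.
pose o : 'I_n := Ordinal (ltnW n2); pose o' : 'I_n := Ordinal n2.
have oo' : o != o' by [].
pose l := rem o (enum 'I_n).
have p : perm_eq (enum 'I_n) (o :: l) by apply: perm_to_rem; rewrite mem_enum.
have u : uniq (o :: l) by rewrite -(perm_uniq p) enum_uniq.
have al j : j \in o :: l by rewrite -(perm_mem p) mem_enum.
have al' j : j != o -> j \in l by have := al j; rewrite inE => /predU1P[->|//]; rewrite eqxx.
apply: (@FT_inj _ _ (o :: l)) => //; first exact: schwartz_decay.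
move=> y b x hy; rewrite -/(FT (o :: l) U y b x s).
apply: (@tensor_vanish _ _ m k.+1 _ y o o') => //.
- by move=> s1 s2 s12; rewrite /FT (sU _ _ s12).
- move=> s1 hs1.
  (* The initial phase is raised so that the [k.+1] shifts by pi / 2 bring it back to [b]. *)
  have := FT_iter_rdiv k.+1 y (b + k.+1%:R * (pi / 2)) x u al hU sU.
  rewrite addrK => <-; rewrite /FT.
  rewrite (@pints_ext _ _ _ _ (fun=> 0)) ?pints0 // => z.
  by rewrite hdiv ?mul0r.
move=> B.
(* The exponent [K.+1 + size l] demanded by [FT_estimate] for [K = k.+1]. *)
pose L := nseq (k.+2 + size l) o ++ l.
have [M hM] : exists M : R, forall s, size s = m ->
    forall x, `|U s x| <= M / weight L x.
  by apply: finite_bound => [s1|z]; [exact: schwartz_weight | exact: weight_gt0].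
have wL (z : V) : weight L z = oneDsqr (z 0 o) ^+ (k.+2 + size l) * weight l z.
  exact: weight_nseq_cat.
pose M' := (n%:R * B) ^+ m * M.
exists (M' * (2 * oneDsqr B) ^+ size l * oneDsqrV_int ^+ (size l).+1) => xi xio hB.
rewrite -FT_contr //; last by move=> s1; exact: schwartz_decay.
have hF z : `|contr m (U^~ z) xi| <= M' / (oneDsqr (z 0 o) ^+ (k.+2 + size l) * weight l z).
  rewrite -wL /M' -mulrA; apply: contr_bound => // s1 hs1; exact: hM.
apply: FT_estimate => //.
  by have [] := @decay_contr [::] m U xi (fun s => schwartz_decay [::] (hU s)).
move=> z q zo qK.
apply: (@moment_reparam m k.+1 U (fun eta z => contr m (U^~ z) eta) xi z o
  M' hU erefl xio _ hm) => // t.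
apply: (le_trans (hF _)).
have M0 : 0 <= M'.
  by have := le_trans (normr_ge0 _) (hF 0);
    rewrite pmulr_lge0 // invr_gt0 mulr_gt0 ?exprn_gt0 ?oneDsqr_gt0 ?weight_gt0.
have -> : (z + t *: xi) 0 o = t by rewrite !mxE zo xio mulr1 add0r.
have tp N : 0 < oneDsqr t ^+ N by rewrite exprn_gt0 // oneDsqr_gt0.
have tw := mulr_gt0 (tp (k.+2 + size l)%N) (weight_gt0 l (z + t *: xi)).
rewrite ler_wpM2l // lef_pV2 ?posrE ?tw ?tp //.
apply: (@le_trans _ _ (oneDsqr t ^+ (k.+2 + size l))).
  by rewrite ler_weXn2l ?leq_addr.
by rewrite ler_peMr ?weight_ge1 // exprn_ge0.
Qed.

End RealCase.

(** * Reduction of complex fields to their real and imaginary parts *)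

Section ComplexParts.
Context {R : realType}.
Notation mu := (@lebesgue_measure R).
Local Open Scope complex_scope.

(** A boolean selects the part, so that both go through one proof. *)
Definition part (b : bool) (z : R[i]) : R := if b then complex.Re z else complex.Im z.

Lemma partD b z w : part b (z + w) = part b z + part b w.
Proof. by case: b z w => [] [? ?] [? ?]. Qed.

Lemma part0 b : part b 0 = 0.
Proof. by case: b. Qed.

Lemma part_sum b (I : Type) (r : seq I) (F : I -> R[i]) :
  part b (\sum_(a <- r) F a) = \sum_(a <- r) part b (F a).
Proof. exact: (big_morph _ (partD b) (part0 b)). Qed.

Lemma part_realMr b z (a : R) : part b (z * a%:C) = part b z * a.
Proof. by case: b z => [] [x y] /=; ring. Qed.

Lemma part_realMl b z (a : R) : part b (a%:C * z) = a * part b z.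
Proof. by rewrite mulrC part_realMr mulrC. Qed.

Lemma part_cintegral b (g : R -> R[i]) :
  part b (cintegral g) = \int[mu]_t part b (g t).
Proof. by case: b. Qed.

Lemma part_cpderiv b (n : nat) (i : 'I_n) (g : 'rV[R]_n -> R[i]) x :
  part b (cpderiv i g x) = pderiv i (fun y => part b (g y)) x.
Proof. by case: b. Qed.

Lemma part_eq0 z : (forall b, part b z = 0) -> z = 0.
Proof. by move=> h; have := h true; have := h false; case: z {h} => x y /= -> ->. Qed.

Context (n : nat).
Notation V := 'rV[R]_n.

Lemma contr_tuple m (c : seq 'I_n -> R) (xi : V) :
  contr m c xi = \sum_(I : m.-tuple 'I_n) c I * \prod_(j < m) xi 0 (tnth I j).
Proof.
elim: m c => [|m IH] c /=.
  rewrite (big_pred1 [tuple]) ?big_ord0 ?mulr1 // => I /=.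
  by apply/esym/eqP; exact: tuple0.
under eq_bigr do rewrite IH mulr_sumr.
rewrite pair_bigA /=.
rewrite (reindex (fun I : m.+1.-tuple 'I_n => (thead I, behead_tuple I))) /=.
  apply: eq_bigr => I _; rewrite big_ord_recl mulrCA [in LHS]mulrA.
  rewrite -mulrA; congr (_ * (_ * _)).
    by rewrite [in RHS](tuple_eta I).
  by apply: eq_bigr => j _; rewrite tnth_behead; congr (xi 0 (tnth I _));
    apply/val_inj; rewrite /= inordK // ltnS.
exists (fun p : 'I_n * m.-tuple 'I_n => cons_tuple p.1 p.2) => [I _|[i I] _].
  by rewrite [RHS]tuple_eta; exact/val_inj.
by rewrite theadE; congr pair; exact/val_inj.
Qed.

(** The value 0 at other lengths makes symmetry and Schwartz regularity hold at every sequence, as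
    [real_vanish] requires. *)
Definition part_seq b m (f : tfield R n m) (s : seq 'I_n) (x : V) : R :=
  if insub s is Some J then part b (f J x) else 0.

Lemma part_seqE b m (f : tfield R n m) (I : m.-tuple 'I_n) x :
  part_seq b f I x = part b (f I x).
Proof. by rewrite /part_seq valK. Qed.

Lemma part_divergence b m (g : tfield R n m) (G : seq 'I_n -> V -> R) :
  (0 < m)%N -> (forall (I : m.-tuple 'I_n) x, G I x = part b (g I x)) ->
  forall (I : m.-1.-tuple 'I_n) x, rdiv G I x = part b (divergence g I x).
Proof.
case: m g => // m g _ hG I x; rewrite /= part_sum; apply: eq_bigr => j _.
rewrite part_cpderiv; congr (pderiv j _ x); apply/funext => y.
by rewrite -hG.
Qed.

Lemma size_iter_predn m p : iter p predn m = (m - p)%N.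
Proof. by elim: p => [|p IH]; rewrite ?subn0 //= IH subnS. Qed.

(** The bound [p <= m] keeps [divergence] away from order 0, where its value is a convention that
    [rdiv] does not follow. *)
Lemma part_iter_divergence b m p (f : tfield R n m) : (p <= m)%N ->
  forall (I : (iter p predn m).-tuple 'I_n) x,
  iter p rdiv (part_seq b f) I x = part b (iter_divergence p f I x).
Proof.
elim: p => [|p IH] pm I x; first exact: part_seqE.
apply: (@part_divergence b (iter p predn m) (iter_divergence p f)).
  by rewrite size_iter_predn subn_gt0.
by move=> J z; apply: IH; exact: ltnW.
Qed.

Lemma symmetric_field_part_seq b m (f : tfield R n m) : symmetric_tfield f ->
  symmetric_field (part_seq b f).
Proof.
move=> sf s t st; apply/funext => x; rewrite /part_seq.
case: insubP => [I sI Is|ns]; case: insubP => [J sJ Jt|nt] //.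
- have /tuple_permP [p pE] : perm_eq I J by rewrite Is Jt.
  congr (part b _); rewrite -(sf p J); congr (f _ x); exact/val_inj.
- by move: nt; rewrite -(perm_size st) sI.
- by move: ns; rewrite (perm_size st) sJ.
Qed.

Lemma schwartz_part_seq b m (f : tfield R n m) :
  (forall I, cschwartz (f I)) -> forall s, schwartz (part_seq b f s).
Proof.
move=> hf s; rewrite /part_seq; case: insubP => [I _ _|_]; last exact: schwartz0.
by have [h1 h2] := hf I; case: b.
Qed.

Lemma part_ray b m (f : tfield R n m) (y xi : V) :
  part b (ray_contraction f y xi) = contr m ((part_seq b f)^~ y) xi.
Proof.
rewrite contr_tuple part_sum; apply: eq_bigr => I _.
by rewrite part_realMr part_seqE.
Qed.

End ComplexParts.

Theorem theorem4p1 (R : realType) (n m k : nat)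
  (hn : (2 <= n)%N) (hm : (1 <= m)%N) (hk : (k <= m - 1)%N)
  (f : tfield R n m) (hf : schwartz_tfield f)
  (hdiv : iter_divergence k.+1 f = 0) :
  moment_transforms k f = 0 -> f = 0.
Proof.
move=> hM; have [fsym fsch] := hf.
have km : (k < m)%N by move: hk; rewrite -ltnS subn1 prednK.
apply/funext => I; apply/funext => x; apply: part_eq0 => b.
rewrite -part_seqE.
apply: (@real_vanish R n m k) => //.
- exact: schwartz_part_seq.
- exact: symmetric_field_part_seq.
- move=> s hs z.
  have hs' : size s == iter k.+1 predn m by rewrite hs size_iter_predn.
  have := part_iter_divergence b f km (Tuple hs') z.
  by rewrite hdiv => E; rewrite -(part0 b); exact: E.
- move=> z eta q e1 ze qk.
  have zeS : (z, eta) \in TSphere R n by rewrite inE.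
  have := congr1 (fun F => F (Ordinal qk) (exist _ (z, eta) zeS)) hM.
  move=> /(congr1 (part b)); rewrite part0 => <-.
  rewrite /moment_transforms /moment_transform /= part_cintegral.
  by apply: eq_Rintegral => t _; rewrite part_realMl part_ray.
- by rewrite size_tuple.
Qed.
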